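(* Let $u\in DG(\Omega,T,\gamma)$. Then there is a constant $c_\infty$, depending only on $c_d$, $\gamma$ and the constants in the weak $(1,2)$-Poincar\'e inequality, such that for all $x_0\in X$, $R>0$, $s_1<s_2$ with $2(s_2-s_1)=R^2$ and $B_R(x_0)\times(s_1,s_2)\subset\Omega\times(0,T)$, we have $$\operatorname*{ess\,sup}_{B_{R/2}(x_0)\times((s_1+s_2)/2,\,s_2)}|u|\le c_\infty\left(\frac{1}{\mu(B_R(x_0))(s_2-s_1)}\int_{s_1}^{s_2}\!\!\int_{B_R(x_0)}|u|^2\,d\mu\,dt\right)^{1/2}.$$
   Context: Setting. $(X,d,\mu)$ is a complete metric space with a Borel measure $\mu$ that is doubling: there is $c\ge1$ with $0<\mu(B_{2r}(x))\le c\,\mu(B_r(x))<\infty$ for all $x\in X$, $r>0$, where $B_r(x)=\{y:d(x,y)<r\}$; $c_d$ is the infimum of such constants. The space supports a weak $(1,2)$-Poincar\'e inequality: there are $C_2>0$, $\Lambda\ge1$ such that for all balls $B_\rho$, all integrable $u$ on $X$ and all upper gradients $g$ of $u$, $\frac1{\mu(B_\rho)}\int_{B_\rho}|u-u_{B_\rho}|\,d\mu\le C_2\rho\big(\frac1{\mu(B_{\Lambda\rho})}\int_{B_{\Lambda\rho}}g^2\,d\mu\big)^{1/2}$, with $u_B$ the $\mu$-average over $B$ and $B_{\Lambda\rho}$ concentric with $B_\rho$. A Borel $g:X\to[0,\infty]$ is an upper gradient of $u$ if $|u(\gamma(0))-u(\gamma(l_\gamma))|\le\int_\gamma g\,ds$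 for all rectifiable paths $\gamma:[0,l_\gamma]\to X$; a $2$-weak upper gradient if this holds for $2$-almost every path (outside a family of zero $2$-modulus); $g_u$ denotes the minimal $2$-weak upper gradient. $N^{1,2}(\Omega)$ is the Newtonian space of $u\in L^2(\Omega)$ with an upper gradient in $L^2(\Omega)$, norm $\|u\|^2=\|u\|_{L^2}^2+\inf_g\|g\|_{L^2}^2$ (functions at distance zero identified); $u\in N^{1,2}_{\rm loc}(\Omega)$ if $u\in N^{1,2}(V)$ for all bounded open $V$ with $\overline V\subset\Omega$. For time-dependent functions, $g_u$ is the minimal weak upper gradient in the space variable at each time. Parabolic De Giorgi classes. Let $\Omega\subset X$ be nonempty and open, $T>0$, $\gamma>0$. A function $u:\Omega\times(0,T)\to\mathbb R$ is in $DG_+(\Omega,T,\gamma)$ if $u\in C([0,T];L^2_{\rm loc}(\Omega))\cap L^2_{\rm loc}(0,T;N^{1,2}_{\rm loc}(\Omega))$ and for all $k\in\mathbb R$ $$\sup_{t\in(\tau,s_2)}\int_{B_r(x_0)}(u-k)_+^2(x,t)\,d\mu+\int_\tau^{s_2}\!\!\int_{B_r(x_0)}g_{(u-k)_+}^2\,d\mu\,ds\le\alpha\int_{B_R(x_0)}(u-k)_+^2(x,s_1)\,d\mu+\gamma\Big(1+\frac{1-\alpha}\theta\Big)\frac1{(R-r)^2}\int_{s_1}^{s_2}\!\!\int_{B_R(x_0)}(u-k)_+^2\,d\mu\,ds$$ whenever $(x_0,t_0)\in\Omega\times(0,T)$, $\theta>0$, $0<r<R$, $\alpha\in[0,1]$,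 $s_1,s_2\in(0,T)$, $s_1<s_2$, are such that $\tau,t_0\in[s_1,s_2]$, $s_2-s_1=\theta R^2$, $\tau-s_1=\theta(R-r)^2$ and $B_R(x_0)\times(t_0-\theta R^2,t_0+\theta R^2)\subset\Omega\times(0,T)$. $DG_-(\Omega,T,\gamma)$ is defined with $(u-k)_-$ in place of $(u-k)_+$, and $DG(\Omega,T,\gamma)=DG_+(\Omega,T,\gamma)\cap DG_-(\Omega,T,\gamma)$. *)

(* Defs.v *)
From HB Require Import structures.
From mathcomp Require Import all_boot all_order all_algebra.
From mathcomp Require Import all_classical all_reals all_analysis.
From mathcomp Require Import measurable_realfun.
Import Order.TTheory GRing.Theory Num.Theory.
Import numFieldTopology.Exports numFieldNormedType.Exports.

Set Implicit Arguments.
Unset Strict Implicit.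
Unset Printing Implicit Defensive.

Local Open Scope classical_set_scope.
Local Open Scope ring_scope.

(* [Complete] includes a base point, which [measurableType] requires; a metric
   space carrying a nonempty open set is nonempty, so nothing is lost. *)
#[short(type="completeMetricType")]
HB.structure Definition CompleteMetric (K : numDomainType) :=
  {M of Metric K M & Complete M}.

Notation borel X := (g_sigma_algebraType (@open X)).

Section measurability.
Context d (T : measurableType d) (R : realType).
Variable mu : {measure set T -> \bar R}.
Local Open Scope ereal_scope.

(* Measurability with respect to the completion of [mu]. The library integral
   of a nonnegative function is a supremum over measurable simple functions
   below it, hence it has the expected value on such functions. *)
Definition ae_measurable (D : set T) (f : T -> R) : Prop :=
  exists2 v : T -> R, measurable_fun D v & ae_eq mu D f v.

Definition ae_integrable (D : set T) (f : T -> R) : Prop :=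
  exists2 v : T -> R, mu.-integrable D (EFin \o v) & ae_eq mu D f v.

Definition L2on (D : set T) (f : T -> R) : Prop :=
  ae_measurable D f /\ \int[mu]_(x in D) ((f x) ^+ 2)%:E < +oo.

Definition average (A : set T) (f : T -> \bar R) : \bar R :=
  ((fine (mu A))^-1)%:E * \int[mu]_(x in A) f x.

(* The library's [ess_sup] is taken over the whole space. *)
Definition ess_sup_on (D : set T) (f : T -> \bar R) : \bar R :=
  ereal_inf [set y | {ae mu, forall x, D x -> f x <= y}].

End measurability.

Section paths.
Context (R : realType) (X : completeMetricType R).
Implicit Types (l : R) (c : R -> X) (u : X -> R) (g rho : X -> \bar R).
Local Open Scope ereal_scope.

Definition path_length c (a b : R) : \bar R :=
  ereal_sup [set (\sum_(0 <= i < size s)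
      mdist (c (nth b (a :: s) i)) (c (nth b (a :: s) i.+1)))%R%:E
    | s in itv_partition a b].

(* [(l, c)] encodes a rectifiable path [0, l] -> X of length [l], parametrized
   by arc length; such a [c] is 1-Lipschitz on [0, l]. Values of [c] outside
   [0, l] are irrelevant. *)
Definition arc_length_path (p : R * (R -> X)) : Prop :=
  (0 <= p.1)%R /\
  forall a b : R, (0 <= a)%R -> (a <= b)%R -> (b <= p.1)%R ->
    path_length p.2 a b = (b - a)%:E.

Definition path_in (V : set X) (p : R * (R -> X)) : Prop :=
  arc_length_path p /\ forall t, `[0%R, p.1]%classic t -> V (p.2 t).

Definition path_integral g (p : R * (R -> X)) : \bar R :=
  \int[lebesgue_measure]_(t in `[0%R, p.1]) g (p.2 t).

Definition ug_inequality u g (p : R * (R -> X)) : Prop :=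
  `|u (p.2 0%R) - u (p.2 p.1)|%:E <= path_integral g p.

Definition nonneg_borel (V : set X) g : Prop :=
  measurable_fun (V : set (borel X)) g /\
  forall x, V x -> 0 <= g x.

Definition upper_gradient (V : set X) u g : Prop :=
  nonneg_borel V g /\ forall p, path_in V p -> ug_inequality u g p.

Variable mu : {measure set (borel X) -> \bar R}.

Definition modulus2 (Gamma : set (R * (R -> X))) : \bar R :=
  ereal_inf [set \int[mu]_x (rho x) ^+ 2 | rho in
    [set rho | nonneg_borel setT rho /\
               forall p, Gamma p -> 1 <= path_integral rho p]].

Definition weak_upper_gradient (V : set X) u g : Prop :=
  nonneg_borel V g /\
  exists2 Gamma : set (R * (R -> X)), modulus2 Gamma = 0 &
    forall p, path_in V p -> ~ Gamma p -> ug_inequality u g p.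

End paths.

Section newtonian.
Context (R : realType) (X : completeMetricType R).
Variable mu : {measure set (borel X) -> \bar R}.
Implicit Types (V Omega : set X) (u : X -> R) (g : X -> \bar R).
Local Open Scope ereal_scope.

Definition well_inside Omega V : Prop :=
  [/\ open V, exists x (r : R), V `<=` ball x r & closure V `<=` Omega].

Definition newtonian V u : Prop :=
  L2on mu V u /\
  exists2 g, upper_gradient V u g & \int[mu]_(x in V) (g x) ^+ 2 < +oo.

Definition newtonian_norm2 V u : \bar R :=
  \int[mu]_(x in V) ((u x) ^+ 2)%:E +
  ereal_inf [set \int[mu]_(x in V) (g x) ^+ 2 | g in upper_gradient V u].

Definition weak_ug_L2loc Omega u g : Prop :=
  weak_upper_gradient mu Omega u g /\
  forall V, well_inside Omega V -> \int[mu]_(x in V) (g x) ^+ 2 < +oo.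

Definition is_minimal_ug Omega u g : Prop :=
  weak_ug_L2loc Omega u g /\
  forall h, weak_ug_L2loc Omega u h ->
    {ae mu, forall x : borel X, Omega x -> g x <= h x}.

(* The minimal 2-weak upper gradient g_u of u in Omega, unique up to null sets;
   by convention it is identically +oo if u has no 2-weak upper gradient that is
   locally square integrable. *)
Definition minimal_ug Omega u : X -> \bar R :=
  xget (cst +oo : X -> \bar R) (is_minimal_ug Omega u).

Definition simple_newtonian V (s : R -> X -> R) : Prop :=
  exists (m : nat) (A : 'I_m -> set R) (f : 'I_m -> X -> R),
    [/\ forall i, measurable (A i), forall i, newtonian V (f i) &
        forall t x, s t x = (\sum_(i < m) \1_(A i) t * f i x)%R].

(* The Bochner space L^2(a, b; N^{1,2}(V)). *)
Definition L2_newtonian V (a b : R) (u : X -> R -> R) : Prop :=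
  [/\ {ae lebesgue_measure, forall t : R, `]a, b[%classic t ->
        newtonian V (u ^~ t)},
      exists2 s : nat -> R -> X -> R, (forall n, simple_newtonian V (s n)) &
        {ae lebesgue_measure, forall t : R, `]a, b[%classic t ->
          newtonian_norm2 V (fun x => s n t x - u x t)%R @[n --> \oo] --> 0} &
      \int[lebesgue_measure]_(t in `]a, b[) newtonian_norm2 V (u ^~ t) < +oo].

Definition L2loc_newtonianloc Omega (T : R) (u : X -> R -> R) : Prop :=
  forall V, well_inside Omega V ->
  forall a b : R, (0 < a)%R -> (a < b)%R -> (b < T)%R -> L2_newtonian V a b u.

(* [w] extends [u], which is only given for times in ]0, T[, to [0, T]. *)
Definition C_L2loc Omega (T : R) (u : X -> R -> R) : Prop :=
  exists2 w : X -> R -> R,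
    (forall x t, Omega x -> `]0%R, T[%classic t -> w x t = u x t) &
    forall V, well_inside Omega V -> forall t, `[0%R, T]%classic t ->
      L2on mu V (w ^~ t) /\
      \int[mu]_(x in V) ((w x s - w x t) ^+ 2)%:E
        @[s --> within `[0%R, T] (nbhs t)] --> 0.

End newtonian.

Section de_giorgi.
Context (R : realType) (X : completeMetricType R).
Variable mu : {measure set (borel X) -> \bar R}.
Local Open Scope ereal_scope.

Definition parabolic_space (Omega : set X) (T : R) (u : X -> R -> R) : Prop :=
  [/\ ae_measurable (mu \x lebesgue_measure) (Omega `*` `]0%R, T[)
        (fun z => u z.1 z.2),
      C_L2loc mu Omega T u & L2loc_newtonianloc mu Omega T u].

(* The Caccioppoli inequalities for v = (u - k)_+ or v = (u - k)_-. *)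
Definition energy_estimates (Omega : set X) (T gamma : R) (v : X -> R -> R) :
    Prop :=
  forall (x0 : X) (t0 theta r rad alpha s1 s2 tau : R),
    Omega x0 -> `]0%R, T[%classic t0 -> (0 < theta)%R ->
    (0 < r)%R -> (r < rad)%R -> `[0%R, 1%R]%classic alpha ->
    `]0%R, T[%classic s1 -> `]0%R, T[%classic s2 -> (s1 < s2)%R ->
    `[s1, s2]%classic tau -> `[s1, s2]%classic t0 ->
    (s2 - s1 = theta * rad ^+ 2)%R -> (tau - s1 = theta * (rad - r) ^+ 2)%R ->
    ball x0 rad `*` `](t0 - theta * rad ^+ 2)%R, (t0 + theta * rad ^+ 2)%R[
      `<=` Omega `*` `]0%R, T[ ->
    ereal_sup [set \int[mu]_(x in ball x0 r) ((v x t) ^+ 2)%:E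
               | t in `]tau, s2[]
    + \int[lebesgue_measure]_(t in `]tau, s2[)
        \int[mu]_(x in ball x0 r) (minimal_ug mu Omega (v ^~ t) x) ^+ 2
    <= alpha%:E * \int[mu]_(x in ball x0 rad) ((v x s1) ^+ 2)%:E
       + (gamma * (1 + (1 - alpha) / theta) / (rad - r) ^+ 2)%:E *
         \int[lebesgue_measure]_(t in `]s1, s2[)
           \int[mu]_(x in ball x0 rad) ((v x t) ^+ 2)%:E.

Definition DG_plus (Omega : set X) (T gamma : R) (u : X -> R -> R) : Prop :=
  parabolic_space Omega T u /\
  forall k : R, energy_estimates Omega T gamma
    (fun x t => Num.max (u x t - k) 0)%R.

Definition DG_minus (Omega : set X) (T gamma : R) (u : X -> R -> R) : Prop :=
  parabolic_space Omega T u /\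
  forall k : R, energy_estimates Omega T gamma
    (fun x t => Num.max (- (u x t - k)) 0)%R.

Definition DG (Omega : set X) (T gamma : R) (u : X -> R -> R) : Prop :=
  DG_plus Omega T gamma u /\ DG_minus Omega T gamma u.

Definition doubling_with (c : R) : Prop :=
  (1 <= c)%R /\ forall (x : X) (r : R), (0 < r)%R ->
    [/\ 0 < mu (ball x (2 * r)%R),
        mu (ball x (2 * r)%R) <= c%:E * mu (ball x r) &
        c%:E * mu (ball x r) < +oo].

Definition doubling : Prop := exists c, doubling_with c.

Definition doubling_constant : R := inf [set c | doubling_with c].

(* The weak (1,2)-Poincare inequality with constants [C2] and [Lam]. *)
Definition poincare (C2 Lam : R) : Prop :=
  forall (x0 : X) (rho : R), (0 < rho)%R ->
  forall (u : X -> R) (g : X -> \bar R),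
    ae_integrable mu setT u -> upper_gradient setT u g ->
    let B := ball x0 rho in
    let uB := fine (average mu B (EFin \o u)) in
    average mu B (fun x => `|u x - uB|%:E) <=
      (C2 * rho)%:E *
      (average mu (ball x0 (Lam * rho)%R) (fun x => (g x) ^+ 2)) `^ (2^-1).

End de_giorgi.

(* Main.v *)
From HB Require Import structures.
Require Import Defs.
From mathcomp Require Import all_boot all_order all_algebra.
From mathcomp Require Import all_classical all_reals all_analysis.
From mathcomp Require Import measurable_realfun.
From mathcomp Require Import ring lra.
Import Order.TTheory GRing.Theory Num.Theory.
Import numFieldTopology.Exports numFieldNormedType.Exports.

Set Implicit Arguments.
Unset Strict Implicit.
Unset Printing Implicit Defensive.

Local Open Scope classical_set_scope.
Local Open Scope ring_scope.

(* De Giorgi iteration on shrinking cylinders, driven by a Nash inequality in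
   place of a Sobolev inequality: for v >= 0, 0 < rho = 2^-m R and concentric
   balls B' in B in B_R whose radii differ by a large multiple of rho,
     int_B' v^2 <= C rho^2 int_B g_v^2 + C c^(2m) (int_B v)^2 / mu(B_R).
   To get it, write v - v_rho as the telescoping sum of v_s - v_2s over
   s = 2^-k rho, where v_s(x) is the mean of v over B_s(x). The (1,2)-Poincare
   inequality bounds each difference by s (mean of g_v^2 over B_Ls(x))^(1/2), and
   since averaging over balls of radius s is bounded on L^1 (Tonelli and doubling)
   the sum is O(rho |g_v|_2) in L^2. The same inequality gives v_s -> v in L^1, so
   that no differentiation or covering theorem is needed.
   The energy estimate controls the energy of (u - k')_+ and, as
   (u - k')_+ <= (u - k)_+^2 / (k' - k), also the L^1 norm of (u - k')_+ at each
   time. With levels K (1 - 2^-j) and rho = 2^(-m0-j) R the L^2 norms on the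
   cylinders decay geometrically as soon as the first one is small compared to K,
   whence u <= K; apply this to u and -u. *)

(** * Integrals of nonmeasurable functions *)

(** A Nash inequality asks only for the L^1 norm beside the energy, so the (1,2)-Poincare inequality
    enters as it is, without being improved to a Sobolev-Poincare inequality. In the iteration the
    energy term gains nothing from small data: [rho^2] and the factor [4^j / R^2] of the energy
    estimate cancel up to [4^-m0], so only the choice of [m0] makes it small. The squared L^1 term
    is quadratic in the previous bound and is made small by the start. The main obstacle is that the
    Poincare inequality concerns integrable functions and true upper gradients on all of X, whereas
    the energy estimate involves a weak upper gradient on Omega, whose inequality may fail on a
    family of paths of zero modulus. Both defects are repaired by making path integrals infinite:
    for paths that leave a ball and, at arbitrarily small cost in energy, for the exceptional paths.
    The bounds on u are obtained at every single time and joined by Tonelli's theorem into one for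
    the product measure. *)

(* The map t |-> int g_{u(t)}^2 of the energy estimates is not known to be
   measurable. The library integral of a nonnegative function is a lower
   integral, for which the following estimates hold without measurability. *)
Section lower_integral.
Context d (T : measurableType d) (R : realType).
Variable mu : {measure set T -> \bar R}.
Local Open Scope ereal_scope.

Import HBNNSimple.

(** A simple function below [f], cut to 0 on a null set containing the exceptional points, keeps its
    integral and lies below [g]. *)
Lemma ae_le_lower_integral (D : set T) (f g : T -> \bar R) :
  (forall x, D x -> 0 <= f x) -> (forall x, D x -> 0 <= g x) ->
  {ae mu, forall x, D x -> f x <= g x} ->
  \int[mu]_(x in D) f x <= \int[mu]_(x in D) g x.
Proof.
move=> f0 g0 [N [mN N0 fgN]].
rewrite !ge0_integralE//; apply: ge_ereal_sup => _ [h /= hf <-].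
pose h' := proj_nnsfun h (measurableC mN).
have -> : sintegral mu h = sintegral mu h'.
  rewrite -!integralT_nnsfun; apply: ae_eq_integral => //.
    exact/measurable_EFinP/measurable_funP.
    exact/measurable_EFinP/measurable_funP.
  exists N; split => // x /= /not_implyP[_]; apply: contra_notP => Nx.
  by rewrite mindicE mem_set// mulr1.
apply: ereal_sup_ubound; exists h' => // x /=.
rewrite mindicE /=; have [Nx|Nx] := pselect (N x).
  rewrite memNset; last by move=> /(_ Nx).
  rewrite mulr0.
  by rewrite patchE; case: ifPn => // /set_mem; exact: g0.
rewrite mem_set// mulr1 (le_trans (hf x))// !patchE.
case: ifPn => // /set_mem Dx; apply: contrapT => fgx; apply: Nx; apply: fgN => /=.
by move/(_ Dx).
Qed.

Lemma le_lower_integral (D : set T) (f g : T -> \bar R) :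
  (forall x, D x -> 0 <= f x) -> (forall x, D x -> f x <= g x) ->
  \int[mu]_(x in D) f x <= \int[mu]_(x in D) g x.
Proof.
move=> f0 fg; apply: ae_le_lower_integral => //; last exact: aeW.
by move=> x Dx; rewrite (le_trans (f0 _ Dx))// fg.
Qed.

Lemma ae_eq_lower_integral (D : set T) (f g : T -> \bar R) :
  (forall x, D x -> 0 <= f x) -> (forall x, D x -> 0 <= g x) ->
  ae_eq mu D f g ->
  \int[mu]_(x in D) f x = \int[mu]_(x in D) g x.
Proof.
move=> f0 g0 fg; apply/eqP; rewrite eq_le; apply/andP; split.
  by apply: ae_le_lower_integral => //; apply: filterS fg => x fg /fg ->.
by apply: ae_le_lower_integral => //; apply: filterS fg => x fg /fg ->.
Qed.

Lemma subset_lower_integral (A B : set T) (f : T -> \bar R) :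
  A `<=` B -> (forall x, B x -> 0 <= f x) ->
  \int[mu]_(x in A) f x <= \int[mu]_(x in B) f x.
Proof.
move=> AB f0; rewrite (integral_mkcond A) (integral_mkcond B).
apply: le_lower_integral => x _; rewrite !patchE.
  by case: ifPn => // /set_mem /AB; exact: f0.
case: ifPn => [/set_mem/AB Bx|_]; first by rewrite mem_set.
by case: ifPn => // /set_mem; exact: f0.
Qed.

(** Lower integrals are not additive in general, but constants can be split off: for a simple [s]
    below [h], the function [(s - M)_+ / C] is measurable and lies below [f]. *)
Lemma lower_integral_affine (D : set T) (h f : T -> \bar R) (C M : R) :
  measurable D -> (0 < C)%R -> (0 <= M)%R ->
  (forall x, D x -> 0 <= h x) -> (forall x, D x -> 0 <= f x) ->
  (forall x, D x -> h x <= C%:E * f x + M%:E) ->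
  \int[mu]_(x in D) h x <= C%:E * \int[mu]_(x in D) f x + M%:E * mu D.
Proof.
move=> mD C0 M0 h0 f0 hf; rewrite [leLHS]ge0_integralE//.
apply: ge_ereal_sup => _ [s /= sh <-].
pose p x := (Num.max (s x - M) 0 / C)%R.
have p0 x : (0 <= p x)%R by rewrite divr_ge0 ?(ltW C0)// le_max lexx orbT.
have mp : measurable_fun D (EFin \o p).
  apply/measurable_EFinP; apply: measurable_funM; last exact: measurable_cst.
  apply: measurable_maxr; last exact: measurable_cst.
  by apply: measurable_funB; [exact: measurable_funTS|exact: measurable_cst].
have pf : \int[mu]_(x in D) (p x)%:E <= \int[mu]_(x in D) f x.
  apply: le_lower_integral => x Dx; first by rewrite lee_fin.
  have := le_trans (sh x) _; rewrite patchE mem_set// => /(_ _ (hf x Dx)).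
  have := f0 x Dx; case: (f x) => [r| |]//=; last by move=> *; rewrite leey.
  rewrite !lee_fin => r0 sC; rewrite /p ler_pdivrMr// ge_max.
  by apply/andP; split; [lra|rewrite mulr_ge0// ltW].
rewrite -integralT_nnsfun.
apply: (@le_trans _ _ (\int[mu]_(x in D) (C%:E * (p x)%:E + cst M%:E x))).
  rewrite (integral_mkcond D); apply: le_lower_integral => x _.
    by rewrite lee_fin.
  rewrite patchE; case: ifPn => [_|Dx].
    rewrite -EFinM -EFinD lee_fin /p mulrC divfK ?gt_eqF//.
    by rewrite -lerBlDr le_max lexx.
  by have := sh x; rewrite patchE (negbTE Dx).
have Cp0 x : D x -> 0 <= C%:E * (p x)%:E.
  by move=> Dx; rewrite mule_ge0// lee_fin// ltW.
have mCp : measurable_fun D (fun x => C%:E * (p x)%:E) by exact: measurable_funeM.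
rewrite ge0_integralD//=.
rewrite integral_cst// leeD2r// ge0_integralZl//.
- by rewrite lee_wpmul2l// lee_fin ltW.
- by move=> x Dx; rewrite lee_fin.
- by rewrite lee_fin ltW.
Qed.

End lower_integral.

(** * Doubling measures *)

Section doubling.
Context (R : realType) (X : completeMetricType R).
Variable mu : {measure set (borel X) -> \bar R}.
Local Open Scope ereal_scope.

Lemma open_mball (x : X) (r : R) : open (ball x r).
Proof.
rewrite openE => y; rewrite ballEmdist /= => xyr; apply/nbhs_ballP.
exists (r - mdist x y)%R; first by rewrite /= subr_gt0.
move=> z; rewrite ballEmdist /= => yz.
by rewrite (le_lt_trans (metric_triangle _ y _))// addrC -ltrBrDr.
Qed.

Lemma measurable_mball (x : X) (r : R) : measurable (ball x r : set (borel X)).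
Proof.
by apply: sub_sigma_algebra; exact: open_mball.
Qed.

Lemma subset_ball (x y : X) (r s : R) : (mdist x y + r <= s)%R ->
  ball y r `<=` ball x s.
Proof.
move=> xrs z; rewrite !ballEmdist /= => yz.
rewrite (le_lt_trans (metric_triangle _ y _))// (lt_le_trans _ xrs)//.
by rewrite ltrD2l.
Qed.

Variable c : R.
Hypothesis dbl : doubling_with mu c.

Lemma doubling_ge1 : (1 <= c)%R. Proof. by case: dbl. Qed.

Let c_gt0 : (0 < c)%R. Proof. exact: lt_le_trans ltr01 doubling_ge1. Qed.

Lemma ball_gt0 (x : X) (r : R) : (0 < r)%R -> 0 < mu (ball x r).
Proof.
move=> r0; have r20 : (0 < r / 2)%R by rewrite divr_gt0.
have [+ _ _] := dbl.2 x _ r20.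
by rewrite mulrC divfK.
Qed.

Lemma ball_lty (x : X) (r : R) : mu (ball x r) < +oo.
Proof.
have [r0|r0] := ltP 0%R r; last first.
  rewrite (_ : ball x r = set0) ?measure0 ?ltry//.
  rewrite ballEmdist; apply/seteqP; split => // y /= /lt_le_trans/(_ r0).
  by rewrite ltNge mdist_ge0.
have [_ _] := dbl.2 x _ r0; rewrite !ltey; apply: contra => /eqP ->.
by rewrite gt0_muley// lte_fin.
Qed.

Lemma ball_fin_num (x : X) (r : R) : mu (ball x r) \is a fin_num.
Proof. by rewrite ge0_fin_numE// ball_lty. Qed.

Definition vol (x : X) (r : R) : R := fine (mu (ball x r)).

Lemma volE (x : X) (r : R) : (vol x r)%:E = mu (ball x r).
Proof. by rewrite fineK// ball_fin_num. Qed.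

Lemma vol_gt0 (x : X) (r : R) : (0 < r)%R -> (0 < vol x r)%R.
Proof. by move=> r0; rewrite -lte_fin volE ball_gt0. Qed.

Lemma vol_ge0 (x : X) (r : R) : (0 <= vol x r)%R.
Proof. exact: fine_ge0. Qed.

Lemma le_vol (x y : X) (r s : R) : (mdist x y + r <= s)%R ->
  (vol y r <= vol x s)%R.
Proof.
move=> xrs; rewrite -lee_fin !volE le_measure ?inE//.
- exact: measurable_mball.
- exact: measurable_mball.
- exact: subset_ball.
Qed.

Lemma vol_double (x : X) (r : R) : (0 < r)%R -> (vol x (2 * r) <= c * vol x r)%R.
Proof. by move=> r0; rewrite -lee_fin EFinM !volE; have [] := dbl.2 x _ r0. Qed.

Lemma vol_pow (x : X) (r : R) (m : nat) : (0 < r)%R ->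
  (vol x (2 ^+ m * r) <= c ^+ m * vol x r)%R.
Proof.
move=> r0; elim: m => [|m IH]; first by rewrite !expr0 !mul1r.
rewrite exprS -mulrA (le_trans (vol_double _ _))//.
  by rewrite mulr_gt0// exprn_gt0.
by rewrite exprS -mulrA ler_pM2l.
Qed.

Lemma vol_compare (x y : X) (r : R) : (mdist x y < r)%R ->
  (vol y r <= c * vol x r)%R.
Proof.
move=> xyr; have r0 : (0 < r)%R by exact: le_lt_trans (mdist_ge0 _ _) xyr.
by apply: le_trans (vol_double x r0); apply: le_vol; lra.
Qed.

Lemma sigma_finite_doubling (x0 : X) :
  @sigma_finite _ (borel X) R setT mu.
Proof.
exists (fun n => ball x0 n%:R).
  apply/seteqP; split => // y _; exists (Num.truncn (mdist x0 y)).+1 => //.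
  by rewrite ballEmdist /=; apply: truncnS_gt.
by move=> n; split; [exact: measurable_mball|exact: ball_lty].
Qed.

(** Tonelli's theorem asks for the sigma-finite structure; [nu] carries it and equals [mu] as a set
    function, so results transfer back by rewriting. *)
Lemma sigma_finite_doubling_measure :
  exists nu : {sigma_finite_measure set (borel X) -> \bar R},
    (nu : set _ -> \bar R) = mu.
Proof.
have sf := sigma_finite_doubling (point : X).
pose H1 := isSFinite.Build _ (borel X) R mu (sfinite_measure_sigma_finite sf).
pose H2 := isSigmaFinite.Build _ _ _ _ sf.
pose nu : {sigma_finite_measure set (borel X) -> \bar R} :=
  HB.pack (Measure.sort mu) H1 H2.
by exists nu.
Qed.

(** Only finitely many centres lie within [n] of a fixed point and have balls of volume above
    [1/(m+1)], since these disjoint balls fit into one ball of finite measure. As all volumes are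
    positive, these classes exhaust [E]. *)
Lemma countable_disjoint_balls (e : R) (E : set X) : (0 < e)%R ->
  trivIset E (ball ^~ e) -> countable E.
Proof.
move=> e0 tE; have [[x0 Ex0]|E0] := pselect (E !=set0); last first.
  rewrite (_ : E = set0); first exact: countable0.
  by apply/seteqP; split => // x Ex; apply: E0; exists x.
rewrite (_ : E = \bigcup_n \bigcup_m
    [set x | [/\ E x, (mdist x0 x < n%:R)%R & (m.+1%:R^-1 < vol x e)%R]]).
  apply: bigcup_countable => // n _; apply: bigcup_countable => // m _.
  apply: finite_set_countable; apply: contrapT.
  pose N : nat := (Num.truncn (m.+1%:R * vol x0 (n%:R + e))).+1.
  move=> /infiniteP/pcard_leP/injfunPex[/= q q_fun q_inj].
  have tq : trivIset setT (fun k => ball (q k) e).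
    apply/trivIsetP => i j _ _ ij; move/trivIsetP : tE; apply.
    - by have [] := q_fun i I.
    - by have [] := q_fun j I.
    - by apply: contra ij => /eqP/q_inj; rewrite !inE => /(_ I I)/eqP.
  have : mu (\bigcup_k ball (q k) e) <= (vol x0 (n%:R + e))%:E.
    rewrite volE le_measure ?inE//.
    - by apply: bigcup_measurable => k _; exact: measurable_mball.
    - exact: measurable_mball.
    move=> y [k _]; have [_ qkn _] := q_fun k I.
    by apply: subset_ball; rewrite lerD2r ltW.
  apply/negP; rewrite -ltNge measure_bigcup//; last first.
    by move=> k _; exact: measurable_mball.
  apply: (@lt_le_trans _ _ (\sum_(0 <= k < N) (m.+1%:R^-1)%:E)); last first.
    rewrite (eq_eseriesl (Q := xpredT)); last by move=> i; rewrite in_setT.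
    apply: le_trans (nneseries_lim_ge N _) => //.
    apply: lee_sum => k _; have [_ _ /ltW] := q_fun k I.
    by rewrite -volE lee_fin.
  rewrite sumEFin lte_fin sumr_const_nat subn0 -(mulr_natl (m.+1%:R^-1)).
  by rewrite ltr_pdivlMr// mulrC; exact: truncnS_gt.
apply/seteqP; split => [x Ex|x [n _ [m _ []]]//].
have [m /[!add0r] mx] := ltr_add_invr (vol_gt0 x e0).
by exists (Num.truncn (mdist x0 x)).+1 => //; exists m => //; split => //;
  exact: truncnS_gt.
Qed.

(** The sequence enumerates the centres of maximal families of disjoint balls of radius [1/(n+1)].
    If [2/(n+1) < e], a point at distance at least [e] from all centres could be added to the
    family. *)
Lemma dense_seq_doubling : exists q : nat -> X,
  forall (x : X) (e : R), (0 < e)%R -> exists n, (mdist (q n) x < e)%R.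
Proof.
suff [D [cD dD]] : exists D : set X, countable D /\
    forall (x : X) (e : R), (0 < e)%R -> exists2 q, D q & (mdist q x < e)%R.
  have /countable_injP[f finj] := cD.
  exists (fun n => xget point [set q | D q /\ f q = n]) => x e e0.
  have [q Dq qx] := dD x e e0; exists (f q).
  case: xgetP => [y _ [Dy fyq]|/(_ q)]; last by case.
  by rewrite (finj y q) ?inE.
pose E n := sval (ex_maximal_disjoint_subcollection
  (fun x : X => ball x (n.+1%:R^-1 : R)) setT).
have EP n : maximal_disjoint_subcollection
    (fun x : X => ball x (n.+1%:R^-1 : R)) (E n) setT.
  by rewrite /E; case: ex_maximal_disjoint_subcollection.
exists (\bigcup_n E n); split.
  apply: bigcup_countable => // n _; have [_ tE _] := EP n.
  by apply: countable_disjoint_balls tE.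
move=> x e e0; have e20 : (0 < e / 2)%R by rewrite divr_gt0.
have [n /[!add0r] ne] := ltr_add_invr e20.
have [_ tE maxE] := EP n.
apply: contrapT => noq.
have far q : E n q -> ball q (n.+1%:R^-1 : R) `&` ball x (n.+1%:R^-1 : R) = set0.
  move=> Eq; apply/seteqP; split => // z [qz xz]; apply: noq.
  exists q; first by exists n.
  move: qz xz; rewrite !ballEmdist /= => qz xz.
  rewrite (le_lt_trans (metric_triangle _ z _))// (metric_sym z).
  by rewrite (splitr e) ltrD// (lt_trans _ ne).
have x0 : (0 < n.+1%:R^-1 :> R)%R by rewrite invr_gt0.
have xball : ball x (n.+1%:R^-1 : R) x by rewrite ballEmdist /= mdistxx.
apply: (maxE (E n `|` [set x])) => //.
  split; first by move=> y Ey; left.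
  move=> /(_ x (or_intror erefl)) /far; rewrite setIid => xx.
  by have : set0 x by rewrite -xx.
apply/trivIsetP => i j [Ei|->] [Ej|->] ij.
- by move/trivIsetP : tE; exact.
- exact: far.
- by rewrite setIC; exact: far.
- by rewrite eqxx in ij.
Qed.

(** An open set of the product need not belong to the product of the Borel sigma-algebras. A dense
    sequence writes this one as a countable union of products of balls. *)
Lemma measurable_mdist_lt (s : R) :
  measurable [set z : borel X * borel X | (mdist (z.1 : X) (z.2 : X) < s)%R].
Proof.
have [q dq] := dense_seq_doubling.
rewrite (_ : [set _ | _] = \bigcup_k \bigcup_n
    (ball (q k) (n.+1%:R^-1 : R) `*` ball (q k) (s - n.+1%:R^-1)%R)).
  apply: bigcup_measurable => k _; apply: bigcup_measurable => n _.
  by apply: measurableX; exact: measurable_mball.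
apply/seteqP; split => [[x y] /= xys|[x y] [k _ [n _ []]] /=]; last first.
  rewrite !ballEmdist /= (metric_sym _ x) => xq qy.
  by rewrite (le_lt_trans (metric_triangle _ (q k) _))// -(subrK (n.+1%:R^-1)%R s)
    addrC ltrD.
have e0 : (0 < (s - mdist x y) / 2)%R by rewrite divr_gt0// subr_gt0.
have [n /[!add0r] ne] := ltr_add_invr e0.
have n0 : (0 < n.+1%:R^-1 :> R)%R by rewrite invr_gt0.
have [k kx] := dq x _ n0.
exists k => //; exists n => //; split; rewrite !ballEmdist //=.
rewrite (le_lt_trans (metric_triangle _ x _))//.
by move: (n.+1%:R^-1)%R kx ne => e kx ne; lra.
Qed.

Lemma measurable_vol (s : R) : measurable_fun setT (vol ^~ s : borel X -> R).
Proof.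
have [nu nuE] := sigma_finite_doubling_measure.
have mK := measurable_mdist_lt s.
rewrite (_ : vol ^~ s = fine \o (nu \o xsection
    [set z : borel X * borel X | (mdist (z.1 : X) (z.2 : X) < s)%R])).
  apply: measurableT_comp; first exact: fine_measurable.
  exact: (measurable_fun_xsection nu mK).
apply/funext => x; rewrite /= /vol nuE; congr (fine (mu _)).
by rewrite ballEmdist; apply/seteqP; split => y; rewrite /xsection /= inE.
Qed.

Lemma measurable_vol_inv (s : R) :
  measurable_fun setT (fun x : borel X => (vol x s)^-1%R).
Proof.
under eq_fun do rewrite -powR_inv1 ?vol_ge0//.
exact: (measurableT_comp (measurable_powR _)) (measurable_vol s).
Qed.

Let KK (s : R) :=
  [set z : borel X * borel X | (mdist (z.1 : X) (z.2 : X) < s)%R].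

Let integral_ball (s : R) (x : X) (F : X -> \bar R) :
  \int[mu]_(y in ball x s) F y = \int[mu]_y (((\1_(KK s) (x, y))%:E * F y)).
Proof.
rewrite integral_mkcond; apply: eq_integral => y _; rewrite patchE indicE.
rewrite ballEmdist /KK; case: ifPn => [/set_mem /= xy|].
  by rewrite mem_set//= mul1e.
by rewrite notin_setE /= => xy; rewrite memNset//= mul0e.
Qed.

Let KK_sym (s : R) (x y : X) : \1_(KK s) (y, x) = \1_(KK s) (x, y) :> R.
Proof.
by rewrite !indicE; congr (nat_of_bool _)%:R; apply/idP/idP;
  rewrite !in_setE /KK /= metric_sym.
Qed.

Lemma measurable_integral_ball (s : R) (F : X -> X -> \bar R) :
  measurable_fun setT (fun z : borel X * borel X => F z.1 z.2) ->
  (forall x y, 0 <= F x y) ->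
  measurable_fun setT (fun x : borel X => \int[mu]_(y in ball x s) F x y).
Proof.
move=> mF F0; have [nu nuE] := sigma_finite_doubling_measure.
under eq_fun do rewrite integral_ball -nuE.
pose G (z : borel X * borel X) := (\1_(KK s) z)%:E * F z.1 z.2.
apply: (measurable_fun_fubini_tonelli_F (m2 := nu) G).
- apply: emeasurable_funM => //; apply/measurable_EFinP.
  exact: measurable_indic (measurable_mdist_lt s).
- by move=> z; rewrite mule_ge0// lee_fin.
Qed.

(** Exchanging the integrals moves the centre of the ball from [y] to [x], and
    [vol x s <= c * vol y s] adapts the normalisation. With [F x y = h x] this bounds averaging on
    L^1; with [F x y = |f y - mean x s|] it turns [point_osc] into [osc]. *)
Lemma ball_tonelli (A A' : set X) (s : R) (F : X -> X -> \bar R) :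
  measurable (A : set (borel X)) -> measurable (A' : set (borel X)) ->
  (0 < s)%R -> (forall y, A y -> ball y s `<=` A') ->
  measurable_fun setT (fun z : borel X * borel X => F z.1 z.2) ->
  (forall x y, 0 <= F x y) ->
  \int[mu]_(y in A) ((vol y s)^-1%:E * \int[mu]_(x in ball y s) F x y) <=
  c%:E * \int[mu]_(x in A') ((vol x s)^-1%:E * \int[mu]_(y in ball x s) F x y).
Proof.
move=> mA mA' s0 AA' mF F0; have [nu nuE] := sigma_finite_doubling_measure.
pose G (z : borel X * borel X) := (\1_(KK s) z)%:E * F z.1 z.2.
have mG : measurable_fun setT G.
  apply: emeasurable_funM => //; apply/measurable_EFinP.
  exact: measurable_indic (measurable_mdist_lt s).
have G0 z : 0 <= G z by rewrite mule_ge0// lee_fin.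
pose w y : \bar R := ((\1_A y)%:E * (vol y s)^-1%:E).
have mw : measurable_fun setT (w : borel X -> \bar R).
  apply: emeasurable_funM; apply/measurable_EFinP.
    exact: measurable_indic.
  exact: measurable_vol_inv.
have w0 y : 0 <= w y by rewrite /w mule_ge0// lee_fin ?invr_ge0 ?vol_ge0.
have -> : \int[mu]_(y in A) ((vol y s)^-1%:E * \int[mu]_(x in ball y s) F x y) =
    \int[nu]_y \int[nu]_x (w y * G (x, y)).
  rewrite nuE integral_mkcond; apply: eq_integral => y _; rewrite patchE.
  rewrite ge0_integralZl//; last exact: measurable_fun_pair1.
  rewrite /w indicE; case: ifPn => yA; last by rewrite !mul0e.
  rewrite mul1e integral_ball; congr (_ * _); apply: eq_integral => x _.
  by rewrite /G KK_sym.
rewrite (fubini_tonelli (fun z : borel X * borel X => w z.1 * G (z.2, z.1))) /=; last 2 first.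
- apply: emeasurable_funM; first exact: measurableT_comp.
  apply: (measurableT_comp mG).
  by apply: measurable_fun_pair.
- by move=> z; rewrite mule_ge0.
have mI := measurable_integral_ball s mF F0.
have mV := measurable_vol_inv s.
rewrite nuE -ge0_integralZl//; last 3 first.
- apply: emeasurable_funM; last exact: measurable_funTS.
  by apply/measurable_EFinP; exact: measurable_funTS.
- move=> x _; rewrite mule_ge0//; last exact: integral_ge0.
  by rewrite lee_fin invr_ge0 vol_ge0.
- by rewrite lee_fin ltW.
rewrite [leRHS]integral_mkcond; apply: le_lower_integral => x _.
  by apply: integral_ge0 => y _; rewrite mule_ge0.
rewrite patchE; case: ifPn => [_|].
  rewrite integral_ball muleA -ge0_integralZl//; last 3 first.
  - apply: emeasurable_funM; last exact: (measurable_fun_pair2 x mF).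
    have mK1 : measurable_fun setT (\1_(KK s) : borel X * borel X -> R).
      exact: measurable_indic (measurable_mdist_lt s).
    by apply/measurable_EFinP; exact: (measurable_fun_pair2 x mK1).
  - by move=> y _; rewrite mule_ge0// lee_fin.
  - by rewrite mule_ge0// lee_fin ?invr_ge0 ?vol_ge0// ltW.
  apply: le_lower_integral => y _; first by rewrite mule_ge0.
  rewrite /G /=; have [xy|xy] := boolP ((x, y) \in KK s); last first.
    by rewrite indicE (negbTE xy) !mul0e !mule0.
  rewrite indicE xy mul1e lee_wpmul2r// /w -EFinM -EFinM lee_fin indicE.
  move: xy; rewrite inE /KK /= metric_sym => xy.
  rewrite (@le_trans _ _ (vol y s)^-1%R)//.
    by case: (_ \in _); rewrite ?mul1r// mul0r invr_ge0 vol_ge0.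
  rewrite -[leRHS]invrK lef_pV2 ?posrE ?invr_gt0 ?divr_gt0 ?vol_gt0//.
  by rewrite invf_div ler_pdivrMr// mulrC vol_compare.
rewrite notin_setE => xA'; rewrite integral0_eq// => y _; rewrite /w /G /=.
have [yA|/negbTE yA] := boolP (y \in A); last by rewrite indicE yA !mul0e.
suff -> : \1_(KK s) (x, y) = 0%R :> R by rewrite mul0e mule0.
rewrite indicE memNset//= /KK /= metric_sym => yx.
by apply: xA'; apply: (AA' y); [exact/set_mem|rewrite ballEmdist].
Qed.

End doubling.

(** * The Nash inequality *)

Section mean_oscillation.
Context (R : realType) (X : completeMetricType R).
Variable mu : {measure set (borel X) -> \bar R}.
Local Open Scope ereal_scope.
Local Notation vol := (vol mu).

Variable f : X -> R.

Definition mean (x : X) (s : R) : R :=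
  (fine (\int[mu]_(y in ball x s) (f y)%:E) / vol x s)%R.

Definition osc (x : X) (s : R) : \bar R :=
  (vol x s)^-1%:E * \int[mu]_(y in ball x s) `|f y - mean x s|%:E.

Variable c : R.
Hypothesis dbl : doubling_with mu c.
Let c_gt0 : (0 < c)%R. Proof. exact: lt_le_trans ltr01 (doubling_ge1 dbl). Qed.

Hypothesis f0 : forall x, (0 <= f x)%R.
Hypothesis mf : measurable_fun setT (f : borel X -> R).

Lemma mean_ge0 x s : (0 <= mean x s)%R.
Proof.
rewrite divr_ge0 ?vol_ge0// fine_ge0// integral_ge0// => y _.
by rewrite lee_fin.
Qed.

Lemma osc_ge0 x s : 0 <= osc x s.
Proof.
apply: mule_ge0; first by rewrite lee_fin invr_ge0 vol_ge0.
by apply: integral_ge0 => y _; rewrite lee_fin.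
Qed.

Lemma measurable_mean s : measurable_fun setT (mean ^~ s : borel X -> R).
Proof.
apply: measurable_funM; last exact: measurable_vol_inv dbl s.
apply: measurableT_comp; first exact: fine_measurable.
apply: (measurable_integral_ball dbl s (F := fun _ y => (f y)%:E)) => //.
by apply/measurable_EFinP; exact: measurableT_comp.
Qed.

Lemma mean_integral x s : (0 < s)%R ->
  \int[mu]_(y in ball x s) (f y)%:E < +oo ->
  \int[mu]_(y in ball x s) (f y)%:E = (mean x s * vol x s)%:E.
Proof.
move=> s0 foo; rewrite /mean divfK ?gt_eqF ?vol_gt0// ?(vol_gt0 dbl)//.
by rewrite fineK// ge0_fin_numE// integral_ge0// => y _; rewrite lee_fin.
Qed.

Lemma integral_osc x s (o : R) : (0 < s)%R -> osc x s <= o%:E ->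
  \int[mu]_(y in ball x s) `|f y - mean x s|%:E <= (o * vol x s)%:E.
Proof.
move=> s0; rewrite /osc; have v0 := vol_gt0 dbl x s0.
have := @integral_ge0 _ _ _ mu (ball x s) (fun y => `|f y - mean x s|%:E).
case: (integral _ _ _) => [i| |] => [_|_|/(_ _)].
- by rewrite -EFinM !lee_fin mulrC ler_pdivrMr.
- by rewrite gt0_muley ?lte_fin ?invr_gt0// leye_eq.
- by move=> _ _; rewrite leNye.
Qed.

Let mball (x : X) (s : R) : measurable (ball x s : set (borel X)) :=
  measurable_mball x s.

Lemma le_integral_ball_const x s (u : X -> \bar R) (k : R) :
  measurable_fun setT (u : borel X -> \bar R) -> (forall y, 0 <= u y) ->
  (0 <= k)%R ->
  \int[mu]_(y in ball x s) (u y + k%:E) =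
  \int[mu]_(y in ball x s) u y + (k * vol x s)%:E.
Proof.
move=> mu0 u0 k0; rewrite ge0_integralD//.
- by rewrite (integral_cst mu (mball x s) k%:E) EFinM (volE dbl).
- exact: measurable_funTS.
Qed.

Let mabs k : measurable_fun setT (fun y : borel X => `|f y - k|%:E).
Proof.
apply/measurable_EFinP; apply: measurableT_comp => //.
exact: measurable_funB.
Qed.

(** Average [|f - mean x s|] over the small ball; enlarging the domain costs the volume ratio [k].
    The two bounds are inequalities between integrals of nonnegative functions, so that no infinite
    integrals are subtracted. *)
Lemma mean_close x z s t (k o : R) : (0 < s)%R -> (0 < t)%R ->
  ball z t `<=` ball x s -> (vol x s <= k * vol z t)%R ->
  \int[mu]_(y in ball x s) (f y)%:E < +oo -> osc x s <= o%:E ->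
  (`|mean z t - mean x s| <= k * o)%R.
Proof.
move=> s0 t0 zx vk foo /(integral_osc s0) oscI.
have vx := vol_gt0 dbl x s0; have vz := vol_gt0 dbl z t0.
have o0 : (0 <= o)%R.
  have : 0 <= (o * vol x s)%:E.
    by apply: le_trans oscI; apply: integral_ge0.
  by rewrite lee_fin pmulr_lge0.
have fz : \int[mu]_(y in ball z t) (f y)%:E < +oo.
  apply: le_lt_trans foo; apply: subset_lower_integral => // y _.
  by rewrite lee_fin.
have oz : \int[mu]_(y in ball z t) `|f y - mean x s|%:E <= (k * o * vol z t)%:E.
  apply: (@le_trans _ _ (\int[mu]_(y in ball x s) `|f y - mean x s|%:E)).
    exact: subset_lower_integral.
  apply: le_trans oscI _; rewrite lee_fin (mulrC k) -mulrA.
  by rewrite ler_wpM2l.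
have mfE : measurable_fun setT (fun y : borel X => (f y)%:E) by exact/measurable_EFinP.
rewrite ler_norml; apply/andP; split.
  have : \int[mu]_(y in ball z t) (0 + (mean x s)%:E) <=
      \int[mu]_(y in ball z t) ((f y)%:E + `|f y - mean x s|%:E).
    apply: le_lower_integral => y _; rewrite add0e -?EFinD lee_fin ?mean_ge0//.
    by have := ler_norm (mean x s - f y); rewrite distrC; lra.
  rewrite (@le_integral_ball_const _ _ (cst 0))// ?mean_ge0// integral0 add0e.
  rewrite ge0_integralD//; last 3 first.
  - by move=> y _; rewrite lee_fin.
  - exact: measurable_funTS.
  - exact: measurable_funTS.
  rewrite mean_integral// => /le_trans/(_ (leeD2l _ oz)).
  rewrite -EFinD lee_fin -mulrDl ler_pM2r// => H.
  by rewrite lerNl opprB lerBlDl.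
have : \int[mu]_(y in ball z t) (f y)%:E <=
    \int[mu]_(y in ball z t) (`|f y - mean x s|%:E + (mean x s)%:E).
  apply: le_lower_integral => y _; first by rewrite lee_fin.
  by rewrite -EFinD lee_fin; have := ler_norm (f y - mean x s); lra.
rewrite le_integral_ball_const// ?mean_ge0// mean_integral//.
move=> /le_trans/(_ (leeD2r _ oz)).
by rewrite -EFinD lee_fin -mulrDl ler_pM2r// lerBlDr.
Qed.

(** The point [y] is fixed and the centre of the mean is averaged, in contrast to [osc]. This is the
    form whose integral over [y] becomes an integral of [osc] by [ball_tonelli]. *)
Definition point_osc (y : X) (s : R) : \bar R :=
  (vol y s)^-1%:E * \int[mu]_(x in ball y s) `|f y - mean x s|%:E.

Lemma le_point_osc y s (M : R) : (0 < s)%R -> (0 <= M)%R ->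
  (forall x, ball y s x -> (mean x s <= M)%R) ->
  (f y)%:E <= point_osc y s + M%:E.
Proof.
move=> s0 M0 meanM; have v0 := vol_gt0 dbl y s0.
have mI : measurable_fun setT (fun x : borel X => `|f y - mean x s|%:E).
  apply/measurable_EFinP; apply: measurableT_comp => //.
  by apply: measurable_funB => //; exact: measurable_mean.
have : \int[mu]_(x in ball y s) (0 + (f y)%:E) <=
    \int[mu]_(x in ball y s) (`|f y - mean x s|%:E + M%:E).
  apply: le_lower_integral => x yx; rewrite add0e -?EFinD lee_fin//.
  have := ler_norm (f y - mean x s).
  by have := meanM _ yx; lra.
rewrite !le_integral_ball_const// integral0 add0e /point_osc.
case: (integral _ _ _) => [i| |].
- rewrite -EFinM -!EFinD !lee_fin -(ler_pM2r v0) mulrDl.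
  by rewrite mulrAC mulVf ?gt_eqF// mul1r.
- by rewrite gt0_muley ?lte_fin ?invr_gt0// addye// => _; rewrite leey.
- by rewrite addNye leeNy_eq.
Qed.

End mean_oscillation.

(** Cauchy-Schwarz for the weights [2^-k], whose sum is below 2. *)
Lemma sqr_half_sum_le (R : realFieldType) (a : nat -> R) (n : nat) :
  ((\sum_(k < n) 2^-1 ^+ k * a k) ^+ 2 <= 2 * \sum_(k < n) 2^-1 ^+ k * a k ^+ 2)%R.
Proof.
elim: n a => [|n IH] a; first by rewrite !big_ord0 expr0n /= mulr0.
rewrite !big_ord_recl /= !expr0 !mul1r.
have := IH (fun k => a k.+1).
have -> : \sum_(i < n) 2^-1 ^+ bump 0 i * a (bump 0 i) =
    2^-1 * \sum_(i < n) 2^-1 ^+ i * a i.+1.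
  by rewrite mulr_sumr; apply: eq_bigr => i _; rewrite /bump /= add1n exprS mulrA.
have -> : \sum_(i < n) 2^-1 ^+ bump 0 i * a (bump 0 i) ^+ 2 =
    2^-1 * \sum_(i < n) 2^-1 ^+ i * a i.+1 ^+ 2.
  by rewrite mulr_sumr; apply: eq_bigr => i _; rewrite /bump /= add1n exprS mulrA.
set S := \sum_(i < n) _; set Q := \sum_(i < n) _ => SQ.
have := sqr_ge0 (a 0%N - 2^-1 * S); nra.
Qed.

Section nash.
Context (R : realType) (X : completeMetricType R).
Variable mu : {measure set (borel X) -> \bar R}.
Local Open Scope ereal_scope.
Local Notation vol := (vol mu).
Variable c : R.
Hypothesis dbl : doubling_with mu c.
Variables (f : X -> R) (h : X -> \bar R).
Hypothesis f0 : forall x, (0 <= f x)%R.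
Hypothesis mf : measurable_fun setT (f : borel X -> R).
Hypothesis h0 : forall x, 0 <= h x.
Hypothesis mh : measurable_fun setT (h : borel X -> \bar R).
Variables (x0 : X) (r r' rho Lam Cp : R).
Hypothesis Lam_ge1 : (1 <= Lam)%R.
Hypothesis Cp_gt0 : (0 < Cp)%R.
Hypothesis rho_gt0 : (0 < rho)%R.
(** Starting in the ball of radius [r], centres of means move by less than [rho], and the Poincare
    inequality on a ball of radius at most [rho] reaches as far as [Lam * rho]. *)
Hypothesis rr' : (r + rho + Lam * rho <= r')%R.
Hypothesis foo : \int[mu]_(y in ball x0 r') (f y)%:E < +oo.
Hypothesis hoo : \int[mu]_(y in ball x0 r') h y < +oo.

Let A x s := (vol x (Lam * s))^-1%:E * \int[mu]_(y in ball x (Lam * s)%R) h y.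

Hypothesis poinc : forall (x : X) (s : R), (0 < s)%R ->
  ball x (Lam * s)%R `<=` ball x0 r' ->
  osc mu f x s <= (Cp * s)%:E * A x s `^ 2^-1.

Let c_ge1 := doubling_ge1 dbl.
Let c_gt0 : (0 < c)%R. Proof. exact: lt_le_trans ltr01 c_ge1. Qed.

Let s (k : nat) : R := (rho * 2^-1 ^+ k)%R.
Let s_gt0 k : (0 < s k)%R. Proof. by rewrite mulr_gt0// exprn_gt0. Qed.
Let sS k : s k = (2 * s k.+1)%R. Proof. by rewrite /s exprS; field. Qed.
Let s_le k : (s k <= rho)%R.
Proof. by rewrite ler_piMr// ?(ltW rho_gt0)// exprn_ile1// ?invr_ge0// invf_le1// ler1n. Qed.

Let A_ge0 x k : 0 <= A x k.
Proof.
apply: mule_ge0; first by rewrite lee_fin invr_ge0 vol_ge0.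
exact: integral_ge0.
Qed.

Let inside x k : ball x0 (r + rho)%R x -> ball x (Lam * s k)%R `<=` ball x0 r'.
Proof.
rewrite ballEmdist /= => xr; apply: subset_ball; apply: le_trans rr'.
by rewrite lerD ?(ltW xr)// ler_wpM2l ?s_le// (le_trans _ Lam_ge1).
Qed.

Let inside1 (x : X) k : ball x (s k) `<=` ball x (Lam * s k)%R.
Proof. by apply: subset_ball; rewrite mdistxx add0r ler_peMl ?(ltW (s_gt0 k)). Qed.

Let fsoo x k : ball x0 (r + rho)%R x -> \int[mu]_(y in ball x (s k)) (f y)%:E < +oo.
Proof.
move=> xr; apply: le_lt_trans foo; apply: subset_lower_integral.
  by apply: subset_trans (inside xr (k := k)); exact: inside1.
by move=> y _; rewrite lee_fin.
Qed.

Let A_fin x k : ball x0 (r + rho)%R x -> A x (s k) \is a fin_num.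
Proof.
move=> xr; rewrite ge0_fin_numE ?A_ge0//; apply: lte_mul_pinfty => //.
  by rewrite lee_fin invr_ge0 vol_ge0.
by apply: le_lt_trans hoo; apply: subset_lower_integral => //; exact: inside.
Qed.

Let a x k : R := Num.sqrt (fine (A x (s k))).

Let osc_a x k : ball x0 (r + rho)%R x -> osc mu f x (s k) <= (Cp * s k * a x k)%:E.
Proof.
move=> xr; apply: (le_trans (poinc (s_gt0 k) (inside xr (k := k)))).
rewrite /a -(fineK (A_fin k xr)) poweR_EFin -EFinM lee_fin powR12_sqrt//.
exact: fine_ge0.
Qed.

Let ball_sub y : ball x0 r y -> ball x0 (r + rho)%R y.
Proof. by rewrite !ballEmdist /= => /lt_le_trans -> //; rewrite lerDl ltW. Qed.

Let mean_step y k : ball x0 r y ->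
  (mean mu f y (s k.+1) <= mean mu f y (s k) + c * (Cp * s k * a y k))%R.
Proof.
move=> /ball_sub yr.
have sub : ball y (s k.+1) `<=` ball y (s k).
  by apply: subset_ball; rewrite mdistxx add0r (sS k); have := s_gt0 k.+1; lra.
have vv := vol_double dbl y (s_gt0 k.+1); rewrite -(sS k) in vv.
have := mean_close dbl f0 mf (s_gt0 k) (s_gt0 k.+1) sub vv (fsoo k yr) (osc_a k yr).
by rewrite ler_norml => /andP[_]; lra.
Qed.

Let mean_sum y n : ball x0 r y ->
  (mean mu f y (s n) <=
   mean mu f y rho + c * Cp * rho * \sum_(k < n) 2^-1 ^+ k * a y k)%R.
Proof.
move=> yr; elim: n => [|n IH].
  by rewrite big_ord0 mulr0 addr0 /s expr0 mulr1.
apply: (le_trans (mean_step n yr)); rewrite big_ord_recr /=.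
by rewrite mulrDr addrA lerD// /s le_eqVlt; apply/orP; left; apply/eqP; ring.
Qed.

(** Radius and centre change together: [ball y (s n)] lies in the ball about [x] of radius
    [4 * s n.+1], whence two doublings and the factor [c ^+ 2]. *)
Let mean_near y x n : ball x0 r y -> ball y (s n.+1) x ->
  (mean mu f x (s n.+1) <= mean mu f y (s n) + c ^+ 2 * (Cp * s n * a y n))%R.
Proof.
move=> /ball_sub yr; rewrite ballEmdist /= => yx.
have sub : ball x (s n.+1) `<=` ball y (s n).
  by apply: subset_ball; rewrite (sS n); lra.
have vv : (vol y (s n) <= c ^+ 2 * vol x (s n.+1))%R.
  apply: le_trans (vol_pow dbl x 2 (s_gt0 _)); apply: (le_vol dbl).
  by rewrite metric_sym (sS n); have := s_gt0 n.+1; lra.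
have := mean_close dbl f0 mf (s_gt0 n) (s_gt0 n.+1) sub vv (fsoo n yr) (osc_a n yr).
by rewrite ler_norml => /andP[_]; lra.
Qed.

Let kap := (c ^+ 2 * Cp * rho)%R.
Let kap_gt0 : (0 < kap)%R. Proof. by rewrite !mulr_gt0// exprn_gt0. Qed.

Let a_ge0 y k : (0 <= a y k)%R. Proof. exact: sqrtr_ge0. Qed.

(** The telescoping stops at radius [s n.+1], with a bound uniform over all centres [x] in
    [ball y (s n.+1)]. Averaging over these centres leaves the remainder [point_osc]. *)
Let f_le y n : ball x0 r y ->
  (f y)%:E <= point_osc mu f y (s n.+1) +
    (mean mu f y rho + kap * \sum_(k < n.+1) 2^-1 ^+ k * a y k)%:E.
Proof.
move=> yr; apply: (le_point_osc dbl f0 mf (s_gt0 _)).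
  apply: addr_ge0; first exact: mean_ge0.
  apply: mulr_ge0; first exact: ltW.
  by apply: sumr_ge0 => k _; rewrite mulr_ge0// exprn_ge0.
move=> x yx; apply: (le_trans (mean_near yr yx)).
rewrite big_ord_recr /= mulrDr addrA; apply: lerD; last first.
  by rewrite /s /kap le_eqVlt; apply/orP; left; apply/eqP; ring.
apply: (le_trans (mean_sum n yr)); rewrite lerD2l ler_wpM2r//.
  by apply: sumr_ge0 => k _; rewrite mulr_ge0// exprn_ge0.
rewrite /kap ler_wpM2r ?(ltW rho_gt0)// ler_wpM2r ?(ltW Cp_gt0)//.
by rewrite expr2 ler_peMl// ltW.
Qed.

(** By Cauchy-Schwarz, [2 * W y] dominates the square of the telescoped sum; being linear in [h], it
    can be integrated term by term. *)
Let W y := \sum_(0 <= k <oo) ((2^-1 ^+ k)%:E * A y (s k)).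

Let mA k : measurable_fun setT (A ^~ k : borel X -> \bar R).
Proof.
apply: emeasurable_funM; first by apply/measurable_EFinP; exact: measurable_vol_inv dbl _.
apply: (measurable_integral_ball dbl _ (F := fun _ y => h y)) => //.
exact: measurableT_comp.
Qed.

Let WA_ge0 y k : 0 <= (2^-1 ^+ k)%:E * A y (s k).
Proof. by rewrite mule_ge0// lee_fin exprn_ge0. Qed.

Let W_ge0 y : 0 <= W y. Proof. by apply: nneseries_ge0 => k _ _. Qed.

Let mW : measurable_fun setT (W : borel X -> \bar R).
Proof.
apply: ge0_emeasurable_sum => [k x _ _|k _]; first exact: WA_ge0.
by apply: measurable_funeM; exact: mA.
Qed.

Let sum_W y n w : ball x0 r y -> W y = w%:E ->
  (\sum_(k < n) 2^-1 ^+ k * a y k <= Num.sqrt (2 * w))%R.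
Proof.
move=> /ball_sub yr Ww.
have sumw : (\sum_(k < n) 2^-1 ^+ k * a y k ^+ 2 <= w)%R.
  rewrite -lee_fin -Ww.
  apply: le_trans (nneseries_lim_ge n _) => //.
  rewrite big_mkord -sumEFin; apply: lee_sum => k _.
  rewrite /a sqr_sqrtr ?fine_ge0// EFinM fineK//; exact: A_fin.
rewrite -[leLHS]ger0_norm; last first.
  by apply: sumr_ge0 => k _; rewrite mulr_ge0// exprn_ge0.
rewrite -sqrtr_sqr ler_wsqrtr// (le_trans (sqr_half_sum_le _ _))//.
by rewrite ler_pM2l.
Qed.

(* The excess of f over the limit of the telescoping sum; it is bounded by
   [point_osc], whose integral tends to 0. *)
Let e y := maxe 0 ((f y)%:E - (mean mu f y rho)%:E - kap%:E * (2%:E * W y) `^ 2^-1).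

Let e_le y n : ball x0 r y -> e y <= point_osc mu f y (s n.+1).
Proof.
move=> yr; have p0 : 0 <= point_osc mu f y (s n.+1).
  apply: mule_ge0; first by rewrite lee_fin invr_ge0 vol_ge0.
  by apply: integral_ge0 => x _; rewrite lee_fin.
rewrite /e ge_max p0 /=.
have := W_ge0 y; case Ww : (W y) => [w| |]// w0; last first.
  by rewrite gt0_muley ?lte_fin// poweRyr// gt0_muley ?lte_fin// -EFinB addeNy leNye.
have -> : (2%:E * w%:E) `^ 2^-1 = (Num.sqrt (2 * w))%:E.
  by rewrite -EFinM poweR_EFin powR12_sqrt// mulr_ge0.
rewrite -EFinM -!EFinD.
have := f_le n yr; case: (point_osc _ _ _ _) p0 => [p| |]//; last by move=> *; rewrite leey.
rewrite -EFinD !lee_fin => _.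
have : (kap * (\sum_(k < n.+1) 2^-1 ^+ k * a y k) <= kap * Num.sqrt (2 * w))%R.
  by rewrite ler_pM2l//; exact: sum_W.
by lra.
Qed.

Let me : measurable_fun setT (e : borel X -> \bar R).
Proof.
apply: measurable_maxe => //; apply: emeasurable_funB.
  apply: emeasurable_funB; first exact/measurable_EFinP.
  by apply/measurable_EFinP; exact: (measurable_mean dbl).
apply: measurable_funeM.
apply: (measurableT_comp (measurable_poweR _)).
exact: measurable_funeM.
Qed.

Let ball_rho (y : X) k : ball x0 r y -> ball y (s k) `<=` ball x0 (r + rho)%R.
Proof.
rewrite ballEmdist /= => yr; apply: subset_ball.
by rewrite lerD// ltW.
Qed.

Let mball (x : X) (t : R) : measurable (ball x t : set (borel X)) :=
  measurable_mball x t.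

Let integral_A k : \int[mu]_(x in ball x0 (r + rho)%R) A x (s k) <=
  c%:E * \int[mu]_(x in ball x0 r') h x.
Proof.
have Ls0 : (0 < Lam * s k)%R by rewrite mulr_gt0// (lt_le_trans ltr01).
have sub (y : X) : ball x0 (r + rho)%R y -> ball y (Lam * s k)%R `<=` ball x0 r'.
  exact: inside.
(* Since [F] ignores the inner variable of the right-hand side, the inner integral there is [h x]
   times the volume of the ball and cancels the normalisation. *)
apply: (le_trans (ball_tonelli dbl (F := fun x _ => h x) (mball _ _)
  (mball _ _) Ls0 sub _ _)) => //.
  exact: measurableT_comp.
rewrite lee_wpmul2l ?lee_fin ?(ltW c_gt0)//.
apply: le_lower_integral => x _.
  apply: mule_ge0; first by rewrite lee_fin invr_ge0 vol_ge0.
  exact: integral_ge0.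
rewrite (integral_cst mu (mball _ _) (h x)) muleCA -(volE dbl) -EFinM.
by rewrite mulVf ?mule1// gt_eqF// (vol_gt0 dbl).
Qed.

Let integral_e n : \int[mu]_(y in ball x0 r) e y <=
  (c * Cp * (vol x0 (r + rho) + c * fine (\int[mu]_(x in ball x0 r') h x)) * s n.+1)%:E.
Proof.
apply: (@le_trans _ _ (\int[mu]_(y in ball x0 r) point_osc mu f y (s n.+1))).
  apply: le_lower_integral => y yr; last exact: e_le.
  by rewrite le_max lexx.
have mF : measurable_fun setT (fun z : borel X * borel X =>
    `|f z.2 - mean mu f z.1 (s n.+1)|%:E).
  apply/measurable_EFinP; apply: measurableT_comp => //.
  apply: measurable_funB; first exact: (measurableT_comp mf measurable_snd).
  exact: (measurableT_comp (measurable_mean dbl f0 mf (s n.+1)) measurable_fst).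
apply: (le_trans (ball_tonelli dbl (F := fun x y => `|f y - mean mu f x (s n.+1)|%:E)
  (mball _ _) (mball x0 (r + rho)%R) (s_gt0 n.+1) (fun y => @ball_rho y n.+1) mF _)) => //.
apply: (@le_trans _ _ (c%:E * ((Cp * s n.+1)%:E *
    \int[mu]_(x in ball x0 (r + rho)%R) (A x (s n.+1)) +
    (Cp * s n.+1)%:E * mu (ball x0 (r + rho)%R)))).
  rewrite lee_wpmul2l ?lee_fin ?(ltW c_gt0)//.
  (* The crude bound [sqrt A <= A + 1] suffices: the factor [s n.+1] alone brings convergence to
     0. *)
  apply: lower_integral_affine => //.
  - by rewrite mulr_gt0.
  - by rewrite ltW// mulr_gt0.
  - move=> x xr; exact: osc_ge0.
  move=> x xr; apply: (le_trans (osc_a _ xr)).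
  rewrite -(fineK (A_fin _ xr)) -EFinM -EFinD lee_fin -[X in (_ <= _ + X)%R]mulr1 -mulrDr.
  rewrite ler_wpM2l// ?ltW ?mulr_gt0//.
  rewrite -(sqr_sqrtr (fine_ge0 (A_ge0 x (s n.+1)))) -/(a _ _).
  by have := sqr_ge0 (a x n.+1 - 2^-1); nra.
rewrite -(volE dbl) -ge0_muleDr ?lee_fin ?vol_ge0 ?integral_ge0//.
apply: (@le_trans _ _ (c%:E * ((Cp * s n.+1)%:E *
  (c%:E * \int[mu]_(x in ball x0 r') h x + (vol x0 (r + rho))%:E)))).
  apply: lee_wpmul2l; first by rewrite lee_fin ltW.
  apply: lee_wpmul2l; first by rewrite lee_fin ltW// mulr_gt0.
  by apply: leeD2r; exact: integral_A.
have hfin : \int[mu]_(x in ball x0 r') h x \is a fin_num.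
  by rewrite ge0_fin_numE// integral_ge0.
rewrite -{1}(fineK hfin) -!EFinM lee_fin le_eqVlt.
by apply/orP; left; apply/eqP; ring.
Qed.

Let e_ae0 : {ae mu, forall y : borel X, ball x0 r y -> e y = 0}.
Proof.
have e0 y : 0 <= e y by rewrite le_max lexx.
have : \int[mu]_(y in ball x0 r) e y = 0.
  apply/eqP; rewrite eq_le integral_ge0// andbT.
  apply/lee_addgt0Pr => eps eps0; rewrite add0e.
  set K := (c * Cp * (vol x0 (r + rho) + c * fine (\int[mu]_(x in ball x0 r') h x)))%R.
  have K0 : (0 <= K)%R.
    rewrite !mulr_ge0 ?(ltW c_gt0) ?(ltW Cp_gt0)// addr_ge0 ?vol_ge0// mulr_ge0//.
      exact: ltW.
    by rewrite fine_ge0// integral_ge0.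
  have K1 : (0 < eps / (K * rho + 1))%R.
    by rewrite divr_gt0// ltr_pwDr// mulr_ge0// ltW.
  have [n /[!add0r] ne] := ltr_add_invr K1.
  apply: (le_trans (integral_e n)); rewrite -/K lee_fin /s mulrA.
  have n2 : (2^-1 ^+ n.+1 <= n.+1%:R^-1 :> R)%R.
    rewrite exprVn lef_pV2 ?posrE ?exprn_gt0// -natrX ler_nat ltnW//.
    exact: ltn_expl.
  have Kr0 : (0 <= K * rho)%R by rewrite mulr_ge0// ltW.
  apply: (le_trans (ler_wpM2l Kr0 n2)).
  rewrite ltr_pdivlMr in ne; last by rewrite ltr_pwDr.
  have : (0 <= n.+1%:R^-1 :> R)%R by rewrite invr_ge0.
  by move: (n.+1%:R^-1 : R)%R ne => q; lra.
move=> e0I.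
have := (ae_eq_integral_abs mu (mball x0 r) (measurable_funTS me)).1.
by under eq_integral do rewrite gee0_abs//; apply.
Qed.

(** Almost everywhere [f <= mean + kap * sqrt (2 W)], hence [f^2 <= 2 mean^2 + 4 kap^2 W]. The terms
    of [W] have integrals at most [2^-k c \int h], so [\int W <= 2 c \int h], and [8 c kap^2] is the
    constant. *)
Lemma mean_energy_estimate :
  \int[mu]_(y in ball x0 r) (f y ^+ 2)%:E <=
  2%:E * \int[mu]_(y in ball x0 r) (mean mu f y rho ^+ 2)%:E +
  (8 * c ^+ 5 * Cp ^+ 2 * rho ^+ 2)%:E * \int[mu]_(x in ball x0 r') h x.
Proof.
apply: (@le_trans _ _ (\int[mu]_(y in ball x0 r)
   (2%:E * (mean mu f y rho ^+ 2)%:E + (4 * kap ^+ 2)%:E * W y))).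
  apply: ae_le_lower_integral => [y _|y _|].
  - by rewrite lee_fin sqr_ge0.
  - by rewrite adde_ge0// mule_ge0// lee_fin ?sqr_ge0// mulr_ge0// sqr_ge0.
  apply: filterS e_ae0 => y /[swap] yr /(_ yr).
  have := W_ge0 y; rewrite /e; case Ww : (W y) => [w| |]// w0; last first.
    move=> _; rewrite gt0_muley ?lte_fin ?mulr_gt0 ?exprn_gt0//.
    by rewrite -EFinM addey ?leey.
  have -> : (2%:E * w%:E) `^ 2^-1 = (Num.sqrt (2 * w))%:E.
    by rewrite -EFinM poweR_EFin powR12_sqrt// mulr_ge0.
  rewrite -EFinM -!EFinD => e0.
  have : ((f y - mean mu f y rho) - kap * Num.sqrt (2 * w))%:E <= 0%:E.
    by rewrite -[leRHS]e0 le_max lexx orbT.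
  rewrite lee_fin => fl; rewrite -?EFinM -?EFinD lee_fin.
  have sq : (Num.sqrt (2 * w) ^+ 2 = 2 * w)%R by rewrite sqr_sqrtr// mulr_ge0.
  have b0 : (0 <= kap * Num.sqrt (2 * w))%R by rewrite mulr_ge0 ?sqrtr_ge0// ltW.
  have m0 := mean_ge0 mu f0 y rho.
  have : ((kap * Num.sqrt (2 * w)) ^+ 2 = 2 * kap ^+ 2 * w)%R.
    by rewrite exprMn sq; ring.
  move: (kap * Num.sqrt (2 * w))%R b0 fl => b b0 fl bE.
  have := sqr_ge0 (mean mu f y rho - b); have := f0 y; nra.
have mm : measurable_fun setT (fun y : borel X => (mean mu f y rho ^+ 2)%:E).
  by apply/measurable_EFinP; apply: measurable_funX; exact: (measurable_mean dbl).
rewrite ge0_integralD//; last 4 first.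
- by move=> y _; rewrite mule_ge0// lee_fin sqr_ge0.
- by apply: measurable_funeM; exact: measurable_funTS.
- by move=> y _; rewrite mule_ge0// lee_fin mulr_ge0// sqr_ge0.
- by apply: measurable_funeM; exact: measurable_funTS.
rewrite ge0_integralZl//; last 2 first.
- exact: measurable_funTS.
- by move=> y _; rewrite lee_fin sqr_ge0.
rewrite leeD2l// ge0_integralZl//; last 2 first.
- exact: measurable_funTS.
- by rewrite lee_fin mulr_ge0// sqr_ge0.
apply: (@le_trans _ _ ((4 * kap ^+ 2)%:E *
    ((2 * c)%:E * \int[mu]_(x in ball x0 r') h x))); last first.
  rewrite muleA -EFinM lee_wpmul2r ?integral_ge0//.
  by rewrite lee_fin /kap le_eqVlt; apply/orP; left; apply/eqP; ring.
apply: lee_wpmul2l; first by rewrite lee_fin mulr_ge0// sqr_ge0.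
rewrite /W integral_nneseries//; last first.
  by move=> k; apply: measurable_funeM; apply: measurable_funTS; exact: mA.
apply: lime_le.
  by apply: is_cvg_nneseries => k _ _; apply: integral_ge0.
near=> n.
apply: (@le_trans _ _ (\sum_(0 <= k < n) ((2^-1 ^+ k)%:E *
    (c%:E * \int[mu]_(x in ball x0 r') h x)))).
  apply: lee_sum => k _; rewrite ge0_integralZl//; last first.
    by apply: measurable_funTS; exact: mA.
  rewrite lee_wpmul2l ?lee_fin ?exprn_ge0//.
  apply: le_trans (integral_A k).
  by apply: subset_lower_integral => // y; exact: ball_sub.
have hfin : \int[mu]_(x in ball x0 r') h x \is a fin_num.
  by rewrite ge0_fin_numE// integral_ge0.
rewrite -(fineK hfin) -!EFinM.
under eq_bigr do rewrite -EFinM.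
rewrite sumEFin lee_fin -mulr_suml -mulrA ler_wpM2r//.
  by rewrite mulr_ge0 ?(ltW c_gt0)// fine_ge0// integral_ge0.
rewrite big_mkord; elim: (n) => [|m IH]; first by rewrite big_ord0.
rewrite big_ord_recl /= expr0.
under eq_bigr do rewrite /bump /= add1n exprS.
by rewrite -mulr_sumr; lra.
Unshelve. all: by end_near.
Qed.

End nash.

(** * The Poincare inequality on balls inside the domain *)

Section paths.
Context (R : realType) (X : completeMetricType R).
Variable mu : {measure set (borel X) -> \bar R}.
Local Open Scope ereal_scope.

Lemma mdist_arc_length (p : R * (R -> X)) (s t : R) : arc_length_path p ->
  (0 <= s)%R -> (s <= t)%R -> (t <= p.1)%R -> (mdist (p.2 s) (p.2 t) <= t - s)%R.
Proof.
move=> [_ pl] s0 st tl; have [->|neq] := eqVneq s t; first by rewrite mdistxx subrr.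
have st' : (s < t)%R by rewrite lt_neqAle neq.
rewrite -lee_fin -(pl s t)//; apply: ereal_sup_ubound; exists [:: t] => /=.
  by rewrite /itv_partition /= st' eqxx.
by rewrite big_nat1.
Qed.

Lemma mdist_arc_length_norm (p : R * (R -> X)) (s t : R) : arc_length_path p ->
  (0 <= s <= p.1)%R -> (0 <= t <= p.1)%R ->
  (mdist (p.2 s) (p.2 t) <= `|t - s|)%R.
Proof.
move=> pl /andP[s0 sl] /andP[t0 tl]; have [st|/ltW ts] := leP s t.
  by rewrite ger0_norm ?subr_ge0// mdist_arc_length.
by rewrite metric_sym ler0_norm ?subr_le0// opprB mdist_arc_length.
Qed.

Lemma path_integral_pinfty (p : R * (R -> X)) (a b : R) (g : X -> \bar R) :
  (forall x, 0 <= g x) -> (0 <= a)%R -> (a < b)%R -> (b <= p.1)%R ->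
  (forall t, `[a, b]%classic t -> g (p.2 t) = +oo) ->
  path_integral g p = +oo.
Proof.
move=> g0 a0 ab bl goo; apply/eqP; rewrite -leye_eq /path_integral.
apply: (@le_trans _ _ (\int[lebesgue_measure]_(t in `[a, b]) (cst +oo) t)).
  rewrite integral_cst//= lebesgue_measure_itv /= lte_fin ab -EFinB.
  by rewrite gt0_mulye// lte_fin subr_gt0.
apply: (@le_trans _ _ (\int[lebesgue_measure]_(t in `[a, b]) g (p.2 t))).
  by apply: le_lower_integral => t abt; rewrite ?goo//= leey.
apply: subset_lower_integral => // t /=; rewrite !in_itv /= => /andP[at_ tb].
by rewrite (le_trans a0)// (le_trans tb).
Qed.

(** Zero modulus provides admissible weights of arbitrarily small energy, which can therefore be
    multiplied by [n.+1]. The bounds on the energies have sum [eps]. *)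
Lemma modulus2_0_weights (Gam : set (R * (R -> X))) (eps : R) : (0 < eps)%R ->
  modulus2 mu Gam = 0 ->
  exists s : nat -> X -> \bar R,
    [/\ forall n, nonneg_borel setT (s n),
        forall n p, Gam p -> n%:R%:E <= path_integral (s n) p &
        forall n, \int[mu]_x (s n x) ^+ 2 <= (eps / (2 ^ n.+1)%:R)%:E].
Proof.
move=> eps0 Gam0.
suff H n : exists s : X -> \bar R, [/\ nonneg_borel setT s,
    forall p, Gam p -> n%:R%:E <= path_integral s p &
    \int[mu]_x (s x) ^+ 2 <= (eps / (2 ^ n.+1)%:R)%:E].
  have [s sP] := choice H.
  by exists s; split=> n; have [] := sP n.
(* Dividing by [n.+1%:R ^+ 2] pays for the multiplication of the weight by [n.+1]. *)
pose d := (eps / (2 ^ n.+1)%:R / (n.+1%:R ^+ 2))%R.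
have d0 : (0 < d)%R by rewrite !divr_gt0// ?exprn_gt0// ltr0n expn_gt0.
have : modulus2 mu Gam < d%:E by rewrite Gam0 lte_fin.
move=> /ereal_inf_lt[_ [rho [rho_b rho1] <-]] rhod.
have [mrho rho0] := rho_b.
exists (fun x => n.+1%:R%:E * rho x); split.
- split; first exact: measurable_funeM.
  by move=> x _; rewrite mule_ge0// rho0.
- move=> p Gp; rewrite /path_integral.
  apply: (@le_trans _ _ (n.+1%:R%:E * path_integral rho p)).
    apply: (@le_trans _ _ (n.+1%:R%:E * 1)).
      by rewrite mule1 lee_fin ler_nat.
    by rewrite lee_wpmul2l// ?lee_fin// rho1.
  have n0 : (0 < n.+1%:R^-1 :> R)%R by rewrite invr_gt0.
  (* Homogeneity of the path integral, from the affine bound with [C = 1/(n+1)] and [M = 0], without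
     asking for measurability of [rho \o p.2]. *)
  have := @lower_integral_affine _ _ _ lebesgue_measure `[0%R, p.1]%classic
    (rho \o p.2) (fun t => n.+1%:R%:E * rho (p.2 t)) _ 0 _ n0 (lexx _).
  rewrite mul0e adde0 => H.
  rewrite -lee_pdivlMl//; apply: H => // t _.
  + exact: rho0.
  + by rewrite mule_ge0// rho0.
  + by rewrite adde0 muleA -EFinM mulVf// mul1e.
- have -> : \int[mu]_x (n.+1%:R%:E * rho x) ^+ 2 =
      (n.+1%:R ^+ 2)%:E * \int[mu]_x (rho x) ^+ 2.
    rewrite -ge0_integralZl//; last 2 first.
    + exact: emeasurable_funM.
    + by move=> x _; exact: sqre_ge0.
    apply: eq_integral => x _.
    by rewrite expr2 EFinM !expe2 muleACA.
  rewrite -lee_pdivlMl ?exprn_gt0// -EFinM mulrC.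
  exact: ltW.
Qed.

(** An arc-length path is 1-Lipschitz: if it is outside the larger ball at time [t], it stays
    outside the smaller one for a time [d]. That interval runs forward when [t] lies in the first
    half of [[0, p.1]] and backward otherwise, so that it fits. *)
Lemma arc_length_leave (p : R * (R -> X)) (x0 : X) (r1 r2 t : R) (g : X -> \bar R) :
  arc_length_path p -> (r1 < r2)%R -> (0 <= t <= p.1)%R -> ~ ball x0 r2 (p.2 t) ->
  (0 < p.1)%R -> (forall x, 0 <= g x) -> (forall x, ~ ball x0 r1 x -> g x = +oo) ->
  path_integral g p = +oo.
Proof.
move=> pl r12 /andP[t0 tl] far l0 g0 goo.
pose d := Num.min (r2 - r1)%R (p.1 / 2)%R.
have d0 : (0 < d)%R by rewrite lt_min subr_gt0 r12 divr_gt0.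
have near u : (0 <= u <= p.1)%R -> (`|u - t| <= d)%R -> g (p.2 u) = +oo.
  move=> up utd; apply: goo => in1; apply: far; move: in1.
  rewrite !ballEmdist /= => x0u.
  rewrite (le_lt_trans (metric_triangle _ (p.2 u) _))//.
  have dd := mdist_arc_length_norm pl up (introT andP (conj t0 tl)).
  rewrite distrC in dd.
  have : (d <= r2 - r1)%R by rewrite ge_min lexx.
  by lra.
have dl : (d <= p.1 / 2)%R by rewrite ge_min lexx orbT.
have [tl2|tl2] := leP t (p.1 / 2)%R.
  apply: (@path_integral_pinfty p t (t + d)%R) => //.
  - by rewrite ltrDl.
  - by lra.
  move=> u /=; rewrite in_itv /= => /andP[tu ut]; apply: near; first by apply/andP; split; lra.
  by rewrite ger0_norm; lra.
apply: (@path_integral_pinfty p (t - d)%R t) => //.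
- by lra.
- by rewrite gtrBl.
move=> u /=; rewrite in_itv /= => /andP[tu ut]; apply: near; first by apply/andP; split; lra.
by rewrite ler0_norm; lra.
Qed.

(* Avoids cutoff functions: a path leaving the larger ball spends a positive
   time in the annulus, where the gradient is +oo. *)
Lemma upper_gradient_pinfty_outside (Omega : set X) (x0 : X) (r1 r2 : R)
    (v : X -> R) (g gt : X -> \bar R) (Gam : set (R * (R -> X))) :
  (r1 < r2)%R -> ball x0 r2 `<=` Omega ->
  (forall p, path_in Omega p -> ~ Gam p -> ug_inequality v g p) ->
  nonneg_borel setT gt ->
  (forall x, Omega x -> 0 <= g x) ->
  (forall x, ball x0 r1 x -> g x <= gt x) ->
  (forall x, ~ ball x0 r1 x -> gt x = +oo) ->
  (forall p, path_in Omega p -> Gam p -> path_integral gt p = +oo) ->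
  upper_gradient setT (v \_ (ball x0 r2)) gt.
Proof.
move=> r12 BO gP gtb g0 gle goo GamP; split => // p [pl _].
have gt0 x : 0 <= gt x by exact: gtb.2.
(* A path of length 0 has integral 0 even for an infinite gradient, but its end points coincide. *)
have [l0|l0] := ltP 0%R p.1; last first.
  have p10 : p.1 = 0%R by apply/eqP; rewrite eq_le l0 pl.1.
  by rewrite /ug_inequality p10 subrr normr0; exact: integral_ge0.
have [leave|stay] := pselect (exists2 t, (0 <= t <= p.1)%R & ~ ball x0 r2 (p.2 t)).
  case: leave => t tp far.
  by rewrite /ug_inequality (arc_length_leave pl r12 tp far l0 gt0 goo) leey.
have inB t : (0 <= t <= p.1)%R -> ball x0 r2 (p.2 t).
  by move=> tp; apply: contrapT => nb; apply: stay; exists t.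
have pO : path_in Omega p.
  by split => // t /=; rewrite in_itv /= => tp; apply: BO; exact: inB.
have [Gp|Gp] := pselect (Gam p).
  by rewrite /ug_inequality GamP// leey.
rewrite /ug_inequality !patchE !mem_set; last 2 first.
- by apply: inB; rewrite lexx pl.1.
- by apply: inB; rewrite lexx pl.1.
apply: (le_trans (gP p pO Gp)); apply: le_lower_integral => t tp.
  by apply: g0; exact: pO.2.
by have [b1|/goo->] := pselect (ball x0 r1 (p.2 t)); [exact: gle|rewrite leey].
Qed.

End paths.

Lemma le_mul_sqrt_eps (R : realType) (o K G : R) : 0 < K -> 0 <= G -> 0 <= o ->
  (forall e, 0 < e -> o <= K * Num.sqrt (G + e)) -> o <= K * Num.sqrt G.
Proof.
move=> K0 G0 o0 H.
have sq e : 0 < e -> o ^+ 2 <= K ^+ 2 * (G + e).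
  move=> e0; have Ge : 0 <= G + e by rewrite addr_ge0// ltW.
  rewrite -(sqr_sqrtr Ge) -exprMn lerXn2r ?nnegrE ?mulr_ge0 ?sqrtr_ge0 ?(ltW K0)//.
  exact: H.
have o2 : o ^+ 2 <= K ^+ 2 * G.
  apply/ler_addgt0Pr => d d0.
  have K20 : 0 < K ^+ 2 by rewrite exprn_gt0.
  apply: (le_trans (sq (d / K ^+ 2) _)); first by rewrite divr_gt0.
  by rewrite mulrDr mulrCA divff ?gt_eqF// mulr1.
rewrite -[leLHS]ger0_norm// -sqrtr_sqr.
rewrite (_ : K * Num.sqrt G = Num.sqrt (K ^+ 2 * G)); first exact: ler_wsqrtr.
by rewrite sqrtrM ?sqr_ge0// sqrtr_sqr ger0_norm// ltW.
Qed.

Section local_poincare.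
Context (R : realType) (X : completeMetricType R).
Variable mu : {measure set (borel X) -> \bar R}.
Local Open Scope ereal_scope.
Local Notation vol := (vol mu).
Variables (c C2 Lam : R).
Hypothesis dbl : doubling_with mu c.
Hypothesis C2_gt0 : (0 < C2)%R.
Hypothesis Lam_ge1 : (1 <= Lam)%R.
Hypothesis poinc : poincare mu C2 Lam.
Variables (Omega : set X) (x0 : X) (r1 r2 : R) (v f : X -> R) (g : X -> \bar R).
Hypothesis oO : open Omega.
Hypothesis r12 : (r1 < r2)%R.
Hypothesis BO : ball x0 r2 `<=` Omega.
Hypothesis f0 : forall x, (0 <= f x)%R.
Hypothesis mf : measurable_fun setT (f : borel X -> R).
Hypothesis fout : forall x, ~ ball x0 r2 x -> f x = 0%R.
Hypothesis vf : {ae mu, forall x : borel X, ball x0 r2 x -> v x = f x}.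
Hypothesis v0 : forall x, (0 <= v x)%R.
Hypothesis foo : \int[mu]_x (f x)%:E < +oo.
Hypothesis wug : weak_upper_gradient mu Omega v g.

Let mball (x : X) (t : R) : measurable (ball x t : set (borel X)) :=
  measurable_mball x t.

(** The upper gradient inequality is pointwise along paths and so concerns [v] itself, cut off by 0.
    Integrals are computed with the Borel function [f], equal to [w] almost everywhere. *)
Let w := v \_ (ball x0 r2).

Let wf : ae_eq mu setT w f.
Proof.
apply: filterS vf => x vfx _; rewrite /w patchE; case: ifPn => [/set_mem/vfx//|].
by rewrite notin_setE => /fout.
Qed.

(* Adding weights in quadratic mean keeps the L^2 norm additive:
   [sqrte (g ^ 2 + \sum s_n ^ 2)] dominates each [s_n], whose integral along an
   exceptional path is at least [n]. *)
Let approx_upper_gradient (eps : R) : (0 < eps)%R ->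
  exists gt, [/\ upper_gradient setT w gt &
    forall A : set X, measurable (A : set (borel X)) -> A `<=` ball x0 r1 ->
      \int[mu]_(y in A) (gt y) ^+ 2 <= \int[mu]_(y in A) (g y) ^+ 2 + eps%:E].
Proof.
move=> eps0; have [[mg g0] [Gam Gam0 gP]] := wug.
have [s [sb s1 s2]] := modulus2_0_weights eps0 Gam0.
have s0 n x : 0 <= s n x by have [_] := sb n; exact.
have ms n : measurable_fun setT (s n : borel X -> \bar R) by have [] := sb n.
pose S x := \sum_(0 <= n <oo) (s n x) ^+ 2.
have S0 x : 0 <= S x by apply: nneseries_ge0 => n _ _; exact: sqre_ge0.
have mS : measurable_fun setT (S : borel X -> \bar R).
  apply: ge0_emeasurable_sum => [n x _ _|n _]; first exact: sqre_ge0.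
  exact: emeasurable_funM.
pose gt x := if x \in (ball x0 r1 : set X) then sqrte ((g x) ^+ 2 + S x) else +oo.
have b12 : ball x0 r1 `<=` ball x0 r2.
  by apply: subset_ball; rewrite mdistxx add0r ltW.
have mO : measurable (Omega : set (borel X)) by exact: sub_sigma_algebra.
have mgB (A : set X) : measurable (A : set (borel X)) -> A `<=` ball x0 r1 ->
    measurable_fun (A : set (borel X)) (fun x => (g x) ^+ 2).
  move=> mA AB; have := measurable_funS mO (subset_trans AB (subset_trans b12 BO)) mg.
  by move=> mgA; exact: emeasurable_funM.
have gt0 x : 0 <= gt x by rewrite /gt; case: ifP => // _; exact: sqrte_ge0.
have inside x : ball x0 r1 x -> (gt x) ^+ 2 = (g x) ^+ 2 + S x.
  move=> bx; rewrite /gt mem_set// sqr_sqrte// adde_ge0//; exact: sqre_ge0.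
exists gt; split.
  apply: (upper_gradient_pinfty_outside r12 BO gP) => //.
  - split => // _; apply: measurable_fun_if => //.
    + apply: (measurable_fun_bool true).
      rewrite (_ : _ @^-1` _ = ball x0 r1); first by rewrite setTI; exact: mball.
      by apply/seteqP; split => x /=; [move=> /set_mem|move=> ?; rewrite mem_set].
    + rewrite setTI (_ : _ @^-1` _ = ball x0 r1); last first.
        by apply/seteqP; split => x /=; [move=> /set_mem|move=> ?; rewrite mem_set].
      have -> : (fun x => sqrte ((g x) ^+ 2 + S x)) =
          (fun x => ((g x) ^+ 2 + S x) `^ 2^-1).
        by apply/funext => y; rewrite poweR12_sqrt// adde_ge0// sqre_ge0.
      apply: (measurableT_comp (measurable_poweR _)).
      apply: emeasurable_funD; last exact: measurable_funTS.
      by apply: mgB => //; exact: mball.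
  - move=> x bx; rewrite /gt mem_set//.
    rewrite -[leLHS]gee0_abs; last by apply: g0; exact/BO/b12.
    rewrite -sqrte_sqr lee_sqrt ?adde_ge0 ?sqre_ge0//.
    by rewrite leeDl.
  - by move=> x bx; rewrite /gt memNset.
  move=> p pO Gp; apply/eqyP => A A0.
  have [n An] : exists n, (A <= n%:R)%R.
    by exists (Num.truncn A).+1; rewrite ltW// truncnS_gt.
  apply: (@le_trans _ _ n%:R%:E); first by rewrite lee_fin.
  apply: (le_trans (s1 n p Gp)); apply: le_lower_integral => t _; first exact: s0.
  rewrite /gt; case: ifP => // _; last by rewrite leey.
  rewrite -[leLHS]gee0_abs// -sqrte_sqr lee_sqrt ?adde_ge0 ?sqre_ge0//.
  rewrite (@le_trans _ _ (S (p.2 t)))//; last by rewrite leeDr ?sqre_ge0.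
  apply: le_trans (nneseries_lim_ge n.+1 _); last by move=> *; exact: sqre_ge0.
  by rewrite big_nat_recr//= leeDr// sume_ge0// => *; exact: sqre_ge0.
move=> A mA AB.
have -> : \int[mu]_(y in A) (gt y) ^+ 2 = \int[mu]_(y in A) ((g y) ^+ 2 + S y).
  by apply: eq_integral => y /set_mem/AB/inside.
rewrite ge0_integralD//; last 3 first.
- by move=> y _; exact: sqre_ge0.
- exact: mgB.
- exact: measurable_funTS.
rewrite leeD2l// (@le_trans _ _ (\int[mu]_y S y))//.
  exact: subset_lower_integral.
rewrite integral_nneseries//; last 2 first.
- by move=> n; exact: emeasurable_funM.
- by move=> n x _; exact: sqre_ge0.
apply: (@le_trans _ _ (\sum_(0 <= n <oo) (eps / (2 ^ n.+1)%:R)%:E)).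
  apply: lee_nneseries => [n _ _|n _]; last exact: s2.
  by apply: integral_ge0 => x _; exact: sqre_ge0.
by apply: epsilon_trick0; exact: ltW.
Qed.

(** The global inequality is applied to [w] and to the approximate upper gradients. Since the
    enlarged ball stays in [ball x0 r1], the infinite values outside are not seen, and [eps] can
    tend to 0. *)
Lemma local_poincare (x : X) (s : R) : (0 < s)%R ->
  ball x (Lam * s)%R `<=` ball x0 r1 ->
  osc mu f x s <= (C2 * s)%:E *
    ((vol x (Lam * s))^-1%:E * \int[mu]_(y in ball x (Lam * s)%R) (g y) ^+ 2) `^ 2^-1.
Proof.
move=> s0 sub; have Ls0 : (0 < Lam * s)%R by rewrite mulr_gt0// (lt_le_trans ltr01).
have vol0 := vol_gt0 dbl x Ls0.
set I := \int[mu]_(y in _) _.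
have I0 : 0 <= I by apply: integral_ge0 => y _; exact: sqre_ge0.
have C20 : (0 < C2 * s)%R by rewrite mulr_gt0.
have [Ioo|Ifin] := eqVneq I +oo.
  by rewrite Ioo gt0_muley ?lte_fin ?invr_gt0// poweRyr// gt0_muley ?lte_fin// leey.
have Ir : I \is a fin_num by rewrite ge0_fin_numE// ltey.
have wint : ae_integrable mu setT w.
  exists f => //; apply/integrableP; split; first exact/measurable_EFinP.
  by under eq_integral do rewrite /= ger0_norm//.
have key eps : (0 < eps)%R -> osc mu f x s <=
    (C2 * s * Num.sqrt ((vol x (Lam * s))^-1 * fine I + eps))%:E.
  (* The error is scaled by the volume so that it is [eps] after averaging over the enlarged
     ball. *)
  move=> eps0; have ev0 : (0 < eps * vol x (Lam * s))%R by rewrite mulr_gt0.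
  have [gt [gtu gtI]] := approx_upper_gradient ev0.
  have := poinc x s0 wint gtu; rewrite /average /= -!/(vol _ _).
  have fs : \int[mu]_(y in ball x s) (f y)%:E < +oo.
    apply: le_lt_trans foo; apply: subset_lower_integral => // y _.
    by rewrite lee_fin.
  have wf' : ae_eq mu (ball x s) w f by exact: ae_eq_subset wf.
  have -> : \int[mu]_(y in ball x s) (w y)%:E = \int[mu]_(y in ball x s) (f y)%:E.
    apply: ae_eq_lower_integral => [y _|y _|]; rewrite ?lee_fin//.
      by rewrite /w patchE; case: ifP.
    by apply: filterS wf' => y wfy /wfy ->.
  rewrite (mean_integral dbl f0 s0 fs) -EFinM /= mulrCA mulVf ?gt_eqF ?(vol_gt0 dbl)// mulr1.
  have -> : \int[mu]_(y in ball x s) `|w y - mean mu f x s|%:E =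
      \int[mu]_(y in ball x s) `|f y - mean mu f x s|%:E.
    apply: ae_eq_lower_integral => [y _|y _|]; rewrite ?lee_fin//.
    by apply: filterS wf' => y wfy /wfy ->.
  move=> /le_trans; apply.
  rewrite [leRHS]EFinM lee_wpmul2l ?lee_fin ?(ltW C20)//.
  rewrite -powR12_sqrt; last first.
    by rewrite addr_ge0 ?(ltW eps0)// mulr_ge0 ?invr_ge0 ?(ltW vol0)// fine_ge0.
  rewrite -poweR_EFin gt0_ler_poweR// ?in_itv /= ?leey ?andbT.
  - rewrite mule_ge0 ?lee_fin ?invr_ge0 ?(ltW vol0)//.
    by apply: integral_ge0 => y _; exact: sqre_ge0.
  - by rewrite lee_fin addr_ge0 ?(ltW eps0)// mulr_ge0 ?invr_ge0 ?(ltW vol0)// fine_ge0.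
  rewrite -lee_pdivlMl ?invr_gt0// invrK.
  apply: (le_trans (gtI _ (mball _ _) sub)).
  rewrite -/I -{1}(fineK Ir) -EFinM -EFinD lee_fin mulrDr mulrA divff ?gt_eqF//.
  by rewrite mul1r lerD2l mulrC.
have o0 := osc_ge0 mu f x s.
have of_ : osc mu f x s \is a fin_num.
  by rewrite ge0_fin_numE//; apply: le_lt_trans (key 1%R ltr01) _; rewrite ltry.
have -> : ((vol x (Lam * s))^-1%:E * I) `^ 2^-1 =
    (Num.sqrt ((vol x (Lam * s))^-1 * fine I))%:E.
  rewrite -{1}(fineK Ir) -EFinM poweR_EFin powR12_sqrt//.
  by rewrite mulr_ge0 ?invr_ge0 ?(ltW vol0)// fine_ge0.
rewrite -EFinM -(fineK of_) lee_fin; apply: le_mul_sqrt_eps => //.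
- by rewrite mulr_ge0 ?invr_ge0 ?(ltW vol0)// fine_ge0.
- exact: fine_ge0.
by move=> eps eps0; rewrite -lee_fin fineK//; exact: key.
Qed.

End local_poincare.

(** * The Nash inequality on a time slice *)

Section slice.
Context (R : realType) (X : completeMetricType R).
Variable mu : {measure set (borel X) -> \bar R}.
Local Open Scope ereal_scope.
Local Notation vol := (vol mu).

(** The default value [+oo] also qualifies, with an empty exceptional family: paths of positive
    length have infinite integral, and the others have equal end points. Hence the existence of a
    minimal weak upper gradient need not be decided. *)
Lemma weak_upper_gradient_minimal (Omega : set X) (v : X -> R) :
  weak_upper_gradient mu Omega v (minimal_ug mu Omega v).
Proof.
rewrite /minimal_ug; case: xgetP => [g -> [[]]//|_].
split; first (split; first exact: measurable_cst).
  by move=> x _; rewrite leey.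
exists set0.
  apply/eqP; rewrite eq_le; apply/andP; split.
    apply: ereal_inf_lbound; exists (cst 0); last first.
      by apply: integral0_eq => x _; rewrite expe2 mule0.
    by split => //; split.
  by apply: le_ereal_inf_tmp => _ [rho _ <-]; apply: integral_ge0 => x _; exact: sqre_ge0.
move=> p [pl _] _; rewrite /ug_inequality.
have [l0|l0] := ltP 0%R p.1; last first.
  have -> : p.1 = 0%R by apply/eqP; rewrite eq_le l0 pl.1.
  by rewrite subrr normr0; apply: integral_ge0 => t _; rewrite leey.
rewrite (@path_integral_pinfty _ _ p 0%R p.1) ?leey//.
by move=> x; rewrite leey.
Qed.

Variables (c C2 Lam : R).
Hypothesis dbl : doubling_with mu c.
Hypothesis C2_gt0 : (0 < C2)%R.
Hypothesis Lam_ge1 : (1 <= Lam)%R.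
Hypothesis poinc : poincare mu C2 Lam.

Let mball (x : X) (t : R) : measurable (ball x t : set (borel X)) :=
  measurable_mball x t.

Let c_gt0 : (0 < c)%R. Proof. exact: lt_le_trans ltr01 (doubling_ge1 dbl). Qed.

(** For [y] in [ball x0 r3], the ball of radius [rad] about [x0] lies in the one of radius
    [2 * rad = 2 ^+ m.+1 * rho] about [y]. So the mean at scale [rho] is at most
    [M * c ^+ m.+1 / vol x0 rad], and its square is integrated over a volume of at most
    [vol x0 rad]. *)
Lemma slice_nash (Omega : set X) (x0 : X) (r3 r2 rad rho M : R) (m : nat)
    (v : X -> R) :
  open Omega -> ball x0 r2 `<=` Omega -> (r2 <= rad)%R -> (0 < rho)%R ->
  (rad = 2 ^+ m * rho)%R -> (r3 + rho + Lam * rho < r2)%R ->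
  (forall x, 0 <= v x)%R -> L2on mu (ball x0 r2) v -> (0 <= M)%R ->
  \int[mu]_(x in ball x0 r2) (v x)%:E <= M%:E ->
  \int[mu]_(x in ball x0 r3) ((v x) ^+ 2)%:E <=
    (8 * c ^+ 5 * C2 ^+ 2 * rho ^+ 2)%:E *
      \int[mu]_(x in ball x0 r2) (minimal_ug mu Omega v x) ^+ 2 +
    (2 * c ^+ (2 * m.+1) * M ^+ 2 / vol x0 rad)%:E.
Proof.
move=> oO BO r2rad rho0 radE r32 v0 [[v' mv' vv'] v2] M0 vM.
pose r1 := (r3 + rho + Lam * rho)%R.
pose g := minimal_ug mu Omega v.
have wug := weak_upper_gradient_minimal Omega v.
have [[mg g0] _] := wug.
(* A Borel representative that is nonnegative everywhere and vanishes off the ball: truncation at 0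
   changes it only on a null set of the ball, as [v] is nonnegative. *)
pose f := (fun x => Num.max (v' x) 0%R) \_ (ball x0 r2).
have f0 x : (0 <= f x)%R.
  by rewrite /f patchE; case: ifP => // _; rewrite le_max lexx orbT.
have mf : measurable_fun setT (f : borel X -> R).
  apply: (measurable_restrictT (fun x : borel X => Num.max (v' x) 0%R) (mball x0 r2)).1.
  by apply: measurable_maxr; [exact: mv'|exact: measurable_cst].
have fout x : ~ ball x0 r2 x -> f x = 0%R.
  by move=> nb; rewrite /f patchE memNset.
have vf : {ae mu, forall x : borel X, ball x0 r2 x -> v x = f x}.
  apply: filterS vv' => x vx bx; rewrite /f patchE mem_set//= -vx//.
  by rewrite max_l.
have r1r2 : (r1 < r2)%R by [].
have b12 : ball x0 r1 `<=` ball x0 r2.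
  by apply: subset_ball; rewrite mdistxx add0r ltW.
have f2 : \int[mu]_(x in ball x0 r2) ((f x) ^+ 2)%:E =
          \int[mu]_(x in ball x0 r2) ((v x) ^+ 2)%:E.
  apply: ae_eq_lower_integral => [y _|y _|]; rewrite ?lee_fin ?sqr_ge0//.
  by apply: filterS vf => x vx bx; rewrite vx.
have fv : \int[mu]_(x in ball x0 r2) (f x)%:E =
          \int[mu]_(x in ball x0 r2) (v x)%:E.
  apply: ae_eq_lower_integral => [y _|y _|]; rewrite ?lee_fin//.
  by apply: filterS vf => x vx bx; rewrite vx.
have foo : \int[mu]_x (f x)%:E < +oo.
  have -> : \int[mu]_x (f x)%:E = \int[mu]_(x in ball x0 r2) (f x)%:E.
    rewrite [RHS]integral_mkcond; apply: eq_integral => x _; rewrite patchE.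
    by case: ifPn => //; rewrite notin_setE => /fout ->.
  by rewrite fv (le_lt_trans vM)// ltry.
have mO : measurable (Omega : set (borel X)) by exact: sub_sigma_algebra.
have mg2 : measurable_fun (ball x0 r1 : set (borel X)) (fun x => (g x) ^+ 2).
  have mgB := measurable_funS mO (subset_trans b12 BO) mg.
  exact: emeasurable_funM.
pose h := (fun x => (g x) ^+ 2) \_ (ball x0 r1).
have h0 x : 0 <= h x by rewrite /h patchE; case: ifP => // _; exact: sqre_ge0.
have mh : measurable_fun setT (h : borel X -> \bar R).
  exact: (measurable_restrictT (fun x : borel X => ((g x) ^+ 2)%E) (mball x0 r1)).1.
have hE (A : set X) : A `<=` ball x0 r1 ->
    \int[mu]_(x in A) h x = \int[mu]_(x in A) (g x) ^+ 2.
  move=> AB; apply: eq_integral => x /set_mem/AB bx.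
  by rewrite /h patchE mem_set.
have volr := vol_gt0 dbl x0 (_ : 0 < rad)%R.
have rad0 : (0 < rad)%R by rewrite radE mulr_gt0// exprn_gt0.
have {}volr := volr rad0.
have rhs0 : 0 <= (2 * c ^+ (2 * m.+1) * M ^+ 2 / vol x0 rad)%:E.
  by rewrite lee_fin divr_ge0 ?(ltW volr)// !mulr_ge0 ?sqr_ge0// exprn_ge0// ltW.
have C0 : (0 < 8 * c ^+ 5 * C2 ^+ 2 * rho ^+ 2)%R by rewrite !mulr_gt0// exprn_gt0.
have I12 : \int[mu]_(x in ball x0 r1) h x <=
    \int[mu]_(x in ball x0 r2) (minimal_ug mu Omega v x) ^+ 2.
  rewrite hE//; apply: subset_lower_integral => // x _; exact: sqre_ge0.
have [hoo|hoo] := eqVneq (\int[mu]_(x in ball x0 r1) h x) +oo.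
  move: I12; rewrite hoo leye_eq => /eqP ->.
  by rewrite gt0_muley ?lte_fin// addye ?leey// gt_eqF// (lt_le_trans _ rhs0).
have vE : \int[mu]_(x in ball x0 r3) ((v x) ^+ 2)%:E =
          \int[mu]_(x in ball x0 r3) ((f x) ^+ 2)%:E.
  apply: ae_eq_lower_integral => [y _|y _|]; rewrite ?lee_fin ?sqr_ge0//.
  have b32 : ball x0 r3 `<=` ball x0 r2.
    apply: subset_trans b12; apply: subset_ball; rewrite mdistxx add0r /r1.
    by rewrite -addrA lerDl addr_ge0 ?mulr_ge0 ?(ltW rho0)// (le_trans _ Lam_ge1).
  by apply: filterS vf => x vx /b32 bx; rewrite vx.
rewrite vE.
have foo1 : \int[mu]_(y in ball x0 r1) (f y)%:E < +oo.
  apply: le_lt_trans foo; apply: subset_lower_integral => // y _.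
  by rewrite lee_fin.
have pc x s : (0 < s)%R -> ball x (Lam * s)%R `<=` ball x0 r1 ->
    osc mu f x s <= (C2 * s)%:E *
    ((vol x (Lam * s))^-1%:E * \int[mu]_(y in ball x (Lam * s)%R) h y) `^ 2^-1.
  move=> s0 sub; rewrite hE//.
  exact: (local_poincare dbl C2_gt0 Lam_ge1 poinc oO r1r2 BO f0 mf fout vf v0 foo wug).
rewrite -ltey in hoo.
have := mean_energy_estimate dbl f0 mf h0 mh Lam_ge1 C2_gt0 rho0 (lexx r1) foo1 hoo pc.
move=> /le_trans; apply; rewrite addeC leeD//; first by rewrite lee_wpmul2l// lee_fin ltW.
pose K := (M * c ^+ m.+1 / vol x0 rad)%R.
have K0 : (0 <= K)%R by rewrite divr_ge0 ?(ltW volr)// mulr_ge0// exprn_ge0// ltW.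
apply: (@le_trans _ _ (2%:E * \int[mu]_(y in ball x0 r3) (cst (K ^+ 2)%:E) y)).
  rewrite lee_wpmul2l//; apply: le_lower_integral => y yr3.
    by rewrite lee_fin sqr_ge0.
  rewrite lee_fin lerXn2r ?nnegrE ?mean_ge0//.
  have vy := vol_gt0 dbl y rho0.
  have mfM : (fine (\int[mu]_(z in ball y rho) (f z)%:E) <= M)%R.
    rewrite -lee_fin fineK; last first.
      rewrite ge0_fin_numE; last by apply: integral_ge0 => z _; rewrite lee_fin.
      apply: le_lt_trans foo; apply: subset_lower_integral => // z _.
      by rewrite lee_fin.
    rewrite -fv in vM; apply: le_trans vM.
    apply: subset_lower_integral; last by move=> z _; rewrite lee_fin.
    apply: subset_ball; move: yr3; rewrite ballEmdist /= => /ltW yr3.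
    apply: le_trans (ltW r32); rewrite (@le_trans _ _ (r3 + rho)%R) ?lerD2r//.
    by rewrite lerDl mulr_ge0 ?(ltW rho0)// (le_trans _ Lam_ge1).
  apply: (@le_trans _ _ (M / vol y rho)%R).
    by rewrite ler_wpM2r// invr_ge0 ltW.
  rewrite /K -mulrA ler_wpM2l// -[leRHS]invrK lef_pV2 ?posrE ?invr_gt0//; last first.
    by rewrite divr_gt0// exprn_gt0.
  rewrite invf_div ler_pdivrMr ?exprn_gt0// mulrC.
  apply: le_trans (vol_pow dbl y m.+1 rho0).
  apply: (le_vol dbl); rewrite exprS -mulrA -radE mulrDl mul1r lerD2r metric_sym.
  move: yr3; rewrite ballEmdist /= => /ltW/le_trans; apply.
  apply: le_trans r2rad; apply: le_trans (ltW r32); rewrite -addrA lerDl.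
  by rewrite addr_ge0 ?mulr_ge0 ?(ltW rho0)// (le_trans _ Lam_ge1).
rewrite (integral_cst mu (mball _ _) (K ^+ 2)%:E) -(volE dbl) -!EFinM lee_fin.
have v3 : (vol x0 r3 <= vol x0 rad)%R.
  apply: (le_vol dbl); rewrite mdistxx add0r.
  apply: le_trans r2rad; apply: le_trans (ltW r32); rewrite -addrA lerDl.
  by rewrite addr_ge0 ?mulr_ge0 ?(ltW rho0)// (le_trans _ Lam_ge1).
apply: (@le_trans _ _ (2 * (K ^+ 2 * vol x0 rad))%R).
  by rewrite ler_pM2l// ler_wpM2l// sqr_ge0.
rewrite le_eqVlt; apply/orP; left; apply/eqP.
rewrite /K mulnC exprM; field; exact: lt0r_neq0.
Qed.

End slice.

(** * De Giorgi iteration *)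

Section caccioppoli.
Context (R : realType) (X : completeMetricType R).
Variable mu : {measure set (borel X) -> \bar R}.
Local Open Scope ereal_scope.
Local Notation vol := (vol mu).

Lemma well_inside_ball (Omega : set X) (x0 : X) (r rad : R) :
  (r < rad)%R -> ball x0 rad `<=` Omega -> well_inside Omega (ball x0 r).
Proof.
move=> rrad BO; split; first exact: open_mball.
  by exists x0, r.
move=> y cy; apply: BO.
have e0 : (0 < rad - r)%R by rewrite subr_gt0.
have [z [x0z yz]] := cy _ (nbhsx_ballx y _ e0).
move: x0z yz; rewrite !ballEmdist /= (metric_sym y) => x0z yz.
by rewrite (le_lt_trans (metric_triangle _ z _))//; lra.
Qed.

Lemma L2on_truncation (A : set X) (k : R) (w : X -> R) :
  measurable (A : set (borel X)) -> mu A < +oo ->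
  L2on mu A w -> L2on mu A (fun x => Num.max (w x - k) 0)%R.
Proof.
move=> mA Aoo [[w' mw' ww'] w2]; split.
  exists (fun x => Num.max (w' x - k) 0)%R.
    by apply: measurable_maxr => //; apply: measurable_funB.
  by apply: filterS ww' => x wx Ax; rewrite wx.
have k2 : (0 <= 2 * k ^+ 2)%R by rewrite mulr_ge0// sqr_ge0.
have two : (0 < 2 :> R)%R by [].
apply: (@le_lt_trans _ _ (2%:E * \int[mu]_(x in A) ((w x) ^+ 2)%:E +
    (2 * k ^+ 2)%:E * mu A)).
  apply: lower_integral_affine => // x _; rewrite ?lee_fin ?sqr_ge0//.
  rewrite -?EFinM -?EFinD ?lee_fin; have [wk|wk] := leP (w x - k)%R 0%R.
    by rewrite expr0n /= addr_ge0// mulr_ge0// sqr_ge0.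
  by have := sqr_ge0 (w x + k); nra.
by rewrite lte_add_pinfty// lte_mul_pinfty// lee_fin.
Qed.

(** Taking [theta] as duration over squared radius turns the coefficient of the energy estimate into
    [Q], and the hypothesis on [a' - a] says that its time [tau] is at most [a']. Both terms on the
    left are nonnegative, so each obeys the bound. *)
Lemma caccioppoli (Omega : set X) (T gamma : R) (v : X -> R -> R)
    (x0 : X) (r rad a a' b x Q : R) :
  energy_estimates mu Omega T gamma v ->
  (0 < gamma)%R -> (0 < r)%R -> (r < rad)%R -> (a < a')%R -> (a' < b)%R ->
  ball x0 rad `*` `](2 * a - b)%R, b[ `<=` Omega `*` `]0%R, T[ ->
  (0 < a)%R -> (b < T)%R ->
  ((b - a) / rad ^+ 2 * (rad - r) ^+ 2 <= a' - a)%R ->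
  \int[lebesgue_measure]_(t in `]a, b[)
     \int[mu]_(x in ball x0 rad) ((v x t) ^+ 2)%:E <= x%:E ->
  (Q = gamma * (1 + rad ^+ 2 / (b - a)) / (rad - r) ^+ 2)%R ->
  (forall t, `]a', b[%classic t ->
    \int[mu]_(x in ball x0 r) ((v x t) ^+ 2)%:E <= (Q * x)%:E) /\
  \int[lebesgue_measure]_(t in `]a', b[)
    \int[mu]_(x in ball x0 r) (minimal_ug mu Omega (v ^~ t) x) ^+ 2 <= (Q * x)%:E.
Proof.
move=> en ga0 r0 rrad aa' a'b sub a0 bT th vx QE.
have rad0 : (0 < rad)%R by apply: lt_trans rrad.
have ab : (a < b)%R by apply: lt_trans a'b.
have ba0 : (0 < b - a)%R by rewrite subr_gt0.
have rad20 : (0 < rad ^+ 2)%R by rewrite exprn_gt0.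
have rr20 : (0 < (rad - r) ^+ 2)%R by rewrite exprn_gt0// subr_gt0.
pose theta := ((b - a) / rad ^+ 2)%R.
have theta0 : (0 < theta)%R by rewrite divr_gt0.
pose tau := (a + theta * (rad - r) ^+ 2)%R.
have taua' : (tau <= a')%R by rewrite /tau -lerBrDl.
have atau : (a <= tau)%R by rewrite lerDl mulr_ge0// ltW.
have thetaE : (theta * rad ^+ 2 = b - a)%R by rewrite /theta divfK ?gt_eqF.
have Ox0 : Omega x0.
  have := sub (x0, (a + b) / 2)%R; case=> //.
  split => /=; first by rewrite ballEmdist /= mdistxx.
  by rewrite in_itv /=; apply/andP; split; lra.
have e1 : ball x0 rad `*` `](a - theta * rad ^+ 2)%R, (a + theta * rad ^+ 2)%R[
    `<=` Omega `*` `]0%R, T[.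
  by rewrite thetaE (_ : a + (b - a) = b)%R; [rewrite (_ : a - (b - a) = 2 * a - b)%R//|]; ring.
have e2 : (b - a = theta * rad ^+ 2)%R by rewrite thetaE.
have e3 : (tau - a = theta * (rad - r) ^+ 2)%R by rewrite /tau addrC addKr.
have i0 (y z w : R) : (y < z)%R -> (z < w)%R -> `]y, w[%classic z.
  by move=> yz zw; rewrite /= in_itv /= yz.
have i1 (y z w : R) : (y <= z)%R -> (z <= w)%R -> `[y, w]%classic z.
  by move=> yz zw; rewrite /= in_itv /= yz.
(* With alpha = 0 and t0 at the bottom time a, the cylinder centred at t0 only
   needs room in the past. *)
have H := en x0 a theta r rad 0%R a b tau Ox0 (i0 _ _ _ a0 (lt_trans ab bT))
  theta0 r0 rrad (i1 _ _ _ (lexx _) ler01) (i0 _ _ _ a0 (lt_trans ab bT))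
  (i0 _ _ _ (lt_trans a0 ab) bT) ab (i1 _ _ _ atau (le_trans taua' (ltW a'b)))
  (i1 _ _ _ (lexx _) (ltW ab)) e2 e3 e1.
rewrite mul0e add0e subr0 div1r /theta invf_div -QE in H.
have Q0 : (0 <= Q)%R.
  rewrite QE divr_ge0 ?(ltW rr20)// mulr_ge0 ?(ltW ga0)// addr_ge0//.
  by rewrite divr_ge0// ltW.
have HQ := le_trans H (lee_wpmul2l _ vx); rewrite lee_fin in HQ.
have {}HQ := HQ Q0; rewrite -EFinM in HQ.
set S := ereal_sup _ in HQ; set G := integral _ _ _ in HQ.
have S0 : 0 <= S.
  apply: (@le_trans _ _ (\int[mu]_(x in ball x0 r) ((v x ((a' + b) / 2)) ^+ 2)%:E)).
    by apply: integral_ge0 => y _; rewrite lee_fin sqr_ge0.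
  apply: ereal_sup_ubound; exists ((a' + b) / 2)%R => //; apply: i0; lra.
have G0 : 0 <= G.
  by apply: integral_ge0 => t _; apply: integral_ge0 => y _; exact: sqre_ge0.
have sub' : `]a', b[ `<=` `]tau, b[.
  by move=> t /=; rewrite !in_itv /= => /andP[at_ ->]; rewrite (le_lt_trans taua').
split.
  move=> t tab; apply: le_trans (le_trans _ HQ); last exact: (leeDl _ G0).
  apply: ereal_sup_ubound; exists t => //; exact: sub'.
apply: (le_trans _ (le_trans _ HQ)); last exact: (leeDr _ S0).
apply: subset_lower_integral => // t _.
by apply: integral_ge0 => y _; exact: sqre_ge0.
Qed.

End caccioppoli.

Lemma truncation_le_sqr (R : realFieldType) (y k k' : R) : k < k' ->
  Num.max (y - k') 0 <= (k' - k)^-1 * Num.max (y - k) 0 ^+ 2.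
Proof.
move=> kk'; have d0 : 0 < k' - k by rewrite subr_gt0.
have [yk'|yk'] := leP (y - k') 0.
  by rewrite mulr_ge0 ?sqr_ge0// invr_ge0 ltW.
have [yk|yk] := leP (y - k) 0; first by lra.
rewrite mulrC ler_pdivlMr// expr2 ler_pM//; lra.
Qed.

Lemma le_truncation (R : realFieldType) (y k k' : R) : k <= k' ->
  Num.max (y - k') 0 ^+ 2 <= Num.max (y - k) 0 ^+ 2.
Proof.
move=> kk'; apply: lerXn2r; rewrite ?nnegrE; [by rewrite le_max lexx orbT..|].
by rewrite ge_max !le_max lexx orbT lerB// orTb.
Qed.

Section step.
Context (R : realType) (X : completeMetricType R).
Variable mu : {measure set (borel X) -> \bar R}.
Local Open Scope ereal_scope.
Local Notation vol := (vol mu).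
Variables (c C2 Lam : R).
Hypothesis dbl : doubling_with mu c.
Hypothesis C2_gt0 : (0 < C2)%R.
Hypothesis Lam_ge1 : (1 <= Lam)%R.
Hypothesis poinc : poincare mu C2 Lam.
Let c_gt0 : (0 < c)%R. Proof. exact: lt_le_trans ltr01 (doubling_ge1 dbl). Qed.

(** The energy estimate is used twice: at level [k] its supremum part bounds the L^1 norm of
    [(u - k')_+] at each time, at level [k'] its gradient part bounds the energy. The result is
    linear plus quadratic in [x], with [rho] to make the linear part small. *)
Lemma de_giorgi_step (Omega : set X) (T gamma : R) (u : X -> R -> R)
    (x0 : X) (rad r1 r2 r3 a a' b k k' rho x Q : R) (m : nat) :
  open Omega -> ball x0 r1 `<=` Omega ->
  (forall l : R, energy_estimates mu Omega T gamma
     (fun x t => Num.max (u x t - l) 0)%R) ->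
  (forall t, `]0%R, T[%classic t -> L2on mu (ball x0 r2) (u ^~ t)) ->
  (0 < gamma)%R -> (0 < r2)%R -> (r2 < r1)%R -> (a < a')%R -> (a' < b)%R ->
  ball x0 r1 `*` `](2 * a - b)%R, b[ `<=` Omega `*` `]0%R, T[ ->
  (0 < a)%R -> (b < T)%R ->
  ((b - a) / r1 ^+ 2 * (r1 - r2) ^+ 2 <= a' - a)%R ->
  (r2 <= rad)%R -> (0 < rho)%R -> (rad = 2 ^+ m * rho)%R ->
  (r3 + rho + Lam * rho < r2)%R ->
  (k < k')%R -> (0 <= x)%R ->
  \int[lebesgue_measure]_(t in `]a, b[)
     \int[mu]_(x in ball x0 r1) ((Num.max (u x t - k) 0)%R ^+ 2)%:E <= x%:E ->
  (Q = gamma * (1 + r1 ^+ 2 / (b - a)) / (r1 - r2) ^+ 2)%R ->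
  \int[lebesgue_measure]_(t in `]a', b[)
    \int[mu]_(x in ball x0 r3) ((Num.max (u x t - k') 0)%R ^+ 2)%:E <=
  (8 * c ^+ 5 * C2 ^+ 2 * rho ^+ 2 * (Q * x) +
   2 * c ^+ (2 * m.+1) * (Q * x / (k' - k)) ^+ 2 / vol x0 rad * (b - a'))%:E.
Proof.
move=> oO BO en L2u ga0 r20 r21 aa' a'b sub a0 bT th r2rad rho0 radE r32 kk' x_ge0 Xx QE.
have [supk _] : _ /\ _ := caccioppoli (en k) ga0 r20 r21 aa' a'b sub a0 bT th Xx QE.
have Xx' : \int[lebesgue_measure]_(t in `]a, b[)
    \int[mu]_(x in ball x0 r1) ((Num.max (u x t - k') 0)%R ^+ 2)%:E <= x%:E.
  apply: le_trans Xx; apply: le_lower_integral => t _.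
    by apply: integral_ge0 => y _; rewrite lee_fin sqr_ge0.
  apply: le_lower_integral => y _; first by rewrite lee_fin sqr_ge0.
  by rewrite lee_fin le_truncation// ltW.
have [_ intk'] : _ /\ _ := caccioppoli (en k') ga0 r20 r21 aa' a'b sub a0 bT th Xx' QE.
have Q0 : (0 <= Q)%R.
  have ab : (0 < b - a)%R by lra.
  rewrite QE divr_ge0 ?sqr_ge0// mulr_ge0 ?(ltW ga0)// addr_ge0//.
  by rewrite divr_ge0 ?sqr_ge0// ltW.
have d0 : (0 < k' - k)%R by rewrite subr_gt0.
pose M := (Q * x / (k' - k))%R.
have M0 : (0 <= M)%R by rewrite divr_ge0 ?(ltW d0)// mulr_ge0.
have C0 : (0 < 8 * c ^+ 5 * C2 ^+ 2 * rho ^+ 2)%R by rewrite !mulr_gt0// exprn_gt0.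
have rad0 : (0 < rad)%R by rewrite radE mulr_gt0// exprn_gt0.
have volr := vol_gt0 dbl x0 rad0.
have N0 : (0 <= 2 * c ^+ (2 * m.+1) * M ^+ 2 / vol x0 rad)%R.
  by rewrite divr_ge0 ?(ltW volr)// mulr_ge0 ?sqr_ge0// mulr_ge0// exprn_ge0// ltW.
have BO2 : ball x0 r2 `<=` Omega.
  by apply: subset_trans BO; apply: subset_ball; rewrite mdistxx add0r ltW.
have slice t : `]a', b[%classic t ->
  \int[mu]_(x in ball x0 r3) ((Num.max (u x t - k') 0)%R ^+ 2)%:E <=
  (8 * c ^+ 5 * C2 ^+ 2 * rho ^+ 2)%:E *
   \int[mu]_(x in ball x0 r2)
     (minimal_ug mu Omega (fun x => Num.max (u x t - k') 0)%R x) ^+ 2 +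
   (2 * c ^+ (2 * m.+1) * M ^+ 2 / vol x0 rad)%:E.
  move=> tab; have tT : `]0%R, T[%classic t.
    by move: tab; rewrite /= !in_itv /= => /andP[ta tb]; apply/andP; split; lra.
  apply: (slice_nash dbl C2_gt0 Lam_ge1 poinc oO BO2 r2rad rho0 radE r32) => //.
  - by move=> y; rewrite le_max lexx orbT.
  - apply: L2on_truncation; [exact: measurable_mball|exact: ball_lty dbl _ _|].
    exact: L2u.
  apply: (@le_trans _ _ ((k' - k)^-1%:E * \int[mu]_(y in ball x0 r2)
      ((Num.max (u y t - k) 0)%R ^+ 2)%:E + 0%:E * mu (ball x0 r2))).
    apply: lower_integral_affine => //.
    - exact: measurable_mball.
    - by rewrite invr_gt0.
    - by move=> y _; rewrite lee_fin le_max lexx orbT.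
    - by move=> y _; rewrite lee_fin sqr_ge0.
    by move=> y _; rewrite adde0 -EFinM lee_fin truncation_le_sqr.
  rewrite mul0e adde0 /M mulrC EFinM lee_wpmul2l ?lee_fin ?invr_ge0 ?(ltW d0)//.
  exact: supk.
apply: (@le_trans _ _ ((8 * c ^+ 5 * C2 ^+ 2 * rho ^+ 2)%:E *
   \int[lebesgue_measure]_(t in `]a', b[) \int[mu]_(x in ball x0 r2)
     (minimal_ug mu Omega (fun x => Num.max (u x t - k') 0)%R x) ^+ 2 +
   (2 * c ^+ (2 * m.+1) * M ^+ 2 / vol x0 rad)%:E * lebesgue_measure (`]a', b[%classic : set R))).
  apply: lower_integral_affine => //.
    by move=> t _; apply: integral_ge0 => y _; rewrite lee_fin sqr_ge0.
  by move=> t _; apply: integral_ge0 => y _; exact: sqre_ge0.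
rewrite lebesgue_measure_itv /= lte_fin a'b -EFinB -EFinM EFinD leeD//.
by rewrite [leRHS]EFinM lee_wpmul2l// lee_fin ltW.
Qed.

End step.

Section iteration.
Context (R : realType) (X : completeMetricType R).
Variable mu : {measure set (borel X) -> \bar R}.
Local Open Scope ereal_scope.
Local Notation vol := (vol mu).
Variables (c C2 Lam : R).
Hypothesis dbl : doubling_with mu c.
Hypothesis C2_gt0 : (0 < C2)%R.
Hypothesis Lam_ge1 : (1 <= Lam)%R.
Hypothesis poinc : poincare mu C2 Lam.
Let c_gt0 : (0 < c)%R. Proof. exact: lt_le_trans ltr01 (doubling_ge1 dbl). Qed.

Variables (Omega : set X) (T gamma : R) (u : X -> R -> R).
Hypothesis oO : open Omega.
Hypothesis gamma_gt0 : (0 < gamma)%R.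
Hypothesis en : forall l : R, energy_estimates mu Omega T gamma
  (fun x t => Num.max (u x t - l) 0)%R.
Hypothesis L2u : forall V t, well_inside Omega V -> `]0%R, T[%classic t ->
  L2on mu V (u ^~ t).
Variables (x0 : X) (rad b K y0 : R) (m0 : nat).
Hypothesis rad_gt0 : (0 < rad)%R.
Hypothesis bT : (b < T)%R.
Hypothesis sub : ball x0 rad `*` `](b - rad ^+ 2 / 4)%R, b[ `<=` Omega `*` `]0%R, T[.
Hypothesis K_gt0 : (0 < K)%R.
Hypothesis y0_ge0 : (0 <= y0)%R.
Hypothesis m0_big : (16 * (1 + Lam) < 2 ^+ m0)%R.

(* At step j the ratio radius^2 / duration is at most 9 and the gap between the
   radii is rad 2^-j / 16, so the factor in the energy estimate is at most
   P 4^j / rad^2. *)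
Let P := (10 * 16 ^+ 2 * gamma)%R.
(** In the quadratic part of a step, the squared energy factor contributes [16^j], the squared level
    gap [4^j] and the volume ratio [c^(2j)]. This [lam] is the inverse of [64 c^2] and absorbs them
    exactly. *)
Let lam := (((8 * c) ^+ 2)^-1)%R.
Hypothesis m0_energy : (8 * c ^+ 5 * C2 ^+ 2 * P / 4 ^+ m0 <= lam / 2)%R.
Hypothesis y0_small : (c ^+ (2 * m0.+1) * P ^+ 2 * y0 <= lam / 2)%R.

(* Outer radii [rr], intermediate radii [rm], initial times [aa], levels [kk]
   and bounds [xx] for the iterated integrals. *)
Let e (j : nat) : R := (2^-1 ^+ j)%R.
Let rr j := (rad * (2^-1 + e j / 4))%R.
Let rm j := (rad * (2^-1 + e j * 3 / 16))%R.
Let aa j := (b - rad ^+ 2 / 16 * (1 + e j ^+ 2))%R.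
Let kk j := (K * (1 - e j))%R.
Let V := vol x0 rad.
Let xx j := (y0 * V * rad ^+ 2 * K ^+ 2 * lam ^+ j)%R.

Hypothesis start :
  \int[lebesgue_measure]_(t in `](b - rad ^+ 2 / 8)%R, b[)
     \int[mu]_(x in ball x0 (rad * (3 / 4))%R) ((Num.max (u x t) 0)%R ^+ 2)%:E <=
  (y0 * vol x0 rad * rad ^+ 2 * K ^+ 2)%:E.

Let e_gt0 j : (0 < e j)%R. Proof. by rewrite exprn_gt0// invr_gt0. Qed.
Let e_le1 j : (e j <= 1)%R.
Proof. by rewrite exprn_ile1// ?invr_ge0// invf_le1// ler1n. Qed.
Let eS j : e j.+1 = (e j / 2)%R. Proof. by rewrite /e exprS mulrC. Qed.
Let rad2_gt0 : (0 < rad ^+ 2)%R. Proof. by rewrite exprn_gt0. Qed.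
Let V_gt0 : (0 < V)%R. Proof. exact: vol_gt0 dbl _ _ _. Qed.
Let P_gt0 : (0 < P)%R. Proof. by rewrite mulr_gt0// mulr_gt0// exprn_gt0. Qed.
Let lam_gt0 : (0 < lam)%R.
Proof. by rewrite invr_gt0 exprn_gt0// mulr_gt0. Qed.
Let e2_gt0 j : (0 < e j ^+ 2)%R. Proof. by rewrite exprn_gt0. Qed.
Let e2_le1 j : (e j ^+ 2 <= 1)%R.
Proof. by rewrite exprn_ile1// ltW. Qed.

Let rm_lt_rr j : (rm j < rr j)%R.
Proof. by rewrite ltr_pM2l// ltrD2l; have := e_gt0 j; lra. Qed.
Let rm_gt_half j : (rad / 2 < rm j)%R.
Proof. by rewrite ltr_pM2l// ltrDl; have := e_gt0 j; lra. Qed.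
Let rr_le j : (rr j <= rad * (3 / 4))%R.
Proof. by rewrite ler_pM2l//; have := e_le1 j; lra. Qed.
Let rr_lt_rad j : (rr j < rad)%R.
Proof. by apply: le_lt_trans (rr_le j) _; rewrite gtr_pMr//; lra. Qed.
Let rm_gt0 j : (0 < rm j)%R.
Proof. by apply: lt_trans (rm_gt_half j); rewrite divr_gt0. Qed.
Let rr_gt0 j : (0 < rr j)%R. Proof. exact: lt_trans (rm_lt_rr j). Qed.
Let ab j : (b - aa j = rad ^+ 2 / 16 * (1 + e j ^+ 2))%R.
Proof. by rewrite /aa; ring. Qed.
Let ab_ge j : (rad ^+ 2 / 16 <= b - aa j)%R.
Proof.
by rewrite ab ler_peMr ?divr_ge0 ?(ltW rad2_gt0)//; have := e2_gt0 j; lra.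
Qed.
Let ab_le j : (b - aa j <= rad ^+ 2 / 8)%R.
Proof. by rewrite ab; have := e2_le1 j; have := rad2_gt0; nra. Qed.
Let aaS j : (aa j.+1 - aa j = rad ^+ 2 * e j ^+ 2 * (3 / 64))%R.
Proof. by rewrite /aa eS; field. Qed.
Let aa_lt j : (aa j < aa j.+1)%R.
Proof. by rewrite -subr_gt0 aaS !mulr_gt0//; lra. Qed.
Let aa_ltb j : (aa j < b)%R.
Proof. by rewrite -subr_gt0; apply: lt_le_trans (ab_ge j); rewrite divr_gt0. Qed.
Let rr_rm j : (rr j - rm j = rad * e j / 16)%R.
Proof. by rewrite /rr /rm; field. Qed.
Let rr2 j : (rad ^+ 2 / 4 <= rr j ^+ 2 <= rad ^+ 2 * (9 / 16))%R.
Proof.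
apply/andP; split.
  rewrite (_ : rad ^+ 2 / 4 = (rad / 2) ^+ 2)%R; last by field.
  rewrite lerXn2r ?nnegrE ?(ltW (rr_gt0 j))//; first by rewrite divr_ge0// ltW.
  exact: ltW (lt_trans (rm_gt_half j) (rm_lt_rr j)).
rewrite (_ : rad ^+ 2 * (9 / 16) = (rad * (3 / 4)) ^+ 2)%R; last by field.
by rewrite lerXn2r ?nnegrE ?(ltW (rr_gt0 j))// mulr_ge0// ltW.
Qed.

Let QQ j := (gamma * (1 + rr j ^+ 2 / (b - aa j)) / (rr j - rm j) ^+ 2)%R.

Let QQ_ge0 j : (0 <= QQ j)%R.
Proof.
rewrite /QQ divr_ge0 ?sqr_ge0// mulr_ge0 ?(ltW gamma_gt0)// addr_ge0//.
by rewrite divr_ge0 ?sqr_ge0// subr_ge0 ltW.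
Qed.

Let QQ_le j : (QQ j <= P / (e j ^+ 2 * rad ^+ 2))%R.
Proof.
rewrite /QQ rr_rm (_ : P / _ = gamma * 10 / (rad * e j / 16) ^+ 2)%R; last first.
  by rewrite /P; field; rewrite !gt_eqF.
rewrite ler_wpM2r ?invr_ge0 ?sqr_ge0// ler_pM2l//.
have ba0 : (0 < b - aa j)%R by rewrite subr_gt0.
suff : (rr j ^+ 2 / (b - aa j) <= 9)%R by lra.
rewrite ler_pdivrMr//; have /andP[_] := rr2 j; have := ab_ge j; lra.
Qed.

(** The duration is at most [rad ^+ 2 / 8], so going back by the same duration before [aa j] stays
    within the depth [rad ^+ 2 / 4] of the given cylinder. *)
Let sub_j j : ball x0 (rr j) `*` `](2 * aa j - b)%R, b[ `<=` Omega `*` `]0%R, T[.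
Proof.
move=> [y t] [/= yr]; rewrite in_itv /= => /andP[at_ tb]; apply: (@sub (y, t)); split => /=.
  by apply: subset_ball yr; rewrite mdistxx add0r ltW.
rewrite in_itv /= tb andbT.
by apply: le_lt_trans at_; have := ab_le j; lra.
Qed.

Let aa_gt0 j : (0 < aa j)%R.
Proof.
have [] := @sub (x0, aa j); last by rewrite /= in_itv /= => _ /andP[].
split => /=; first by rewrite ballEmdist /= mdistxx.
rewrite in_itv /= aa_ltb andbT; have := ab_le j; have := rad2_gt0; lra.
Qed.

Let BO : ball x0 rad `<=` Omega.
Proof.
move=> y yr; have [] // := @sub (y, aa 0).
split => //=; rewrite in_itv /= aa_ltb andbT.
by have := ab_le 0; have := rad2_gt0; lra.
Qed.

Let BOj j : ball x0 (rr j) `<=` Omega.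
Proof.
by apply: subset_trans BO; apply: subset_ball; rewrite mdistxx add0r ltW.
Qed.

Let time_j j : ((b - aa j) / rr j ^+ 2 * (rr j - rm j) ^+ 2 <= aa j.+1 - aa j)%R.
Proof.
have /andP[r4 _] := rr2 j; have rp : (0 < rr j ^+ 2)%R by rewrite exprn_gt0.
have half : ((b - aa j) / rr j ^+ 2 <= 2^-1)%R.
  by rewrite ler_pdivrMr//; have := ab_le j; lra.
apply: (@le_trans _ _ (2^-1 * (rr j - rm j) ^+ 2)%R).
  by rewrite ler_wpM2r// sqr_ge0.
rewrite aaS rr_rm !exprMn.
by have := mulr_gt0 rad2_gt0 (e2_gt0 j); lra.
Qed.

Let xx_ge0 j : (0 <= xx j)%R.
Proof.
rewrite /xx mulr_ge0 ?exprn_ge0 ?(ltW lam_gt0)// mulr_ge0 ?sqr_ge0//.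
by rewrite mulr_ge0 ?sqr_ge0// mulr_ge0// ltW.
Qed.

Let decay j :
  \int[lebesgue_measure]_(t in `]aa j, b[)
     \int[mu]_(x in ball x0 (rr j)) ((Num.max (u x t - kk j) 0)%R ^+ 2)%:E <=
  (xx j)%:E.
Proof.
elim: j => [|j IH].
  rewrite (_ : aa 0 = b - rad ^+ 2 / 8)%R; last by rewrite /aa /e expr0; field.
  rewrite (_ : rr 0 = rad * (3 / 4))%R; last by rewrite /rr /e expr0; field.
  rewrite (_ : xx 0 = y0 * V * rad ^+ 2 * K ^+ 2)%R; last by rewrite /xx expr0 mulr1.
  apply: le_trans start; rewrite /kk /e expr0 subrr mulr0.
  apply: le_lower_integral => t _.
    by apply: integral_ge0 => y _; rewrite lee_fin sqr_ge0.
  by apply: le_lower_integral => y _; rewrite lee_fin ?sqr_ge0// subr0.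
have rho0 : (0 < rad * e j / 2 ^+ m0)%R by rewrite !mulr_gt0// invr_gt0 exprn_gt0.
have radE : rad = (2 ^+ (m0 + j) * (rad * e j / 2 ^+ m0))%R.
  rewrite exprD /e exprVn; field.
  by rewrite !expf_neq0.
(* The gap between [rm j] and [rr j.+1] is [rad * e j / 16], which [m0_big] makes larger than
   [(1 + Lam) * rho]. *)
have r32 : (rr j.+1 + rad * e j / 2 ^+ m0 + Lam * (rad * e j / 2 ^+ m0) < rm j)%R.
  have q0 : (0 < (2 ^+ m0)^-1 :> R)%R by rewrite invr_gt0 exprn_gt0.
  have q16 : ((16 * (1 + Lam)) / 2 ^+ m0 < 1)%R.
    by rewrite ltr_pdivrMr ?exprn_gt0// mul1r.
  have z0 : (0 < rad * e j)%R by rewrite mulr_gt0.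
  rewrite /rr /rm eS; move: q16 z0; rewrite -(ltr_pM2l (mulr_gt0 rad_gt0 (e_gt0 j))).
  by move: ((2 ^+ m0)^-1)%R => q; lra.
have kkS : (kk j < kk j.+1)%R.
  by rewrite ltr_pM2l// eS; have := e_gt0 j; lra.
have rm_rad : (rm j <= rad)%R by rewrite ltW// (lt_trans (rm_lt_rr j)).
have L2j t : `]0%R, T[%classic t -> L2on mu (ball x0 (rm j)) (u ^~ t).
  apply: L2u; apply: well_inside_ball BO.
  exact: lt_trans (rm_lt_rr j) (rr_lt_rad j).
apply: (le_trans (de_giorgi_step dbl C2_gt0 Lam_ge1 poinc oO (@BOj j) en L2j
  gamma_gt0 (rm_gt0 j) (rm_lt_rr j) (aa_lt j) (aa_ltb j.+1) (@sub_j j) (aa_gt0 j)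
  bT (time_j j) rm_rad rho0 radE r32 kkS (xx_ge0 j) IH (erefl (QQ j)))).
rewrite lee_fin.
have xj0 := xx_ge0 j; have ej0 := e_gt0 j.
pose Qb := (P / (e j ^+ 2 * rad ^+ 2))%R.
have Qx : (QQ j * xx j <= Qb * xx j)%R by rewrite ler_wpM2r.
have Qx0 : (0 <= QQ j * xx j)%R by rewrite mulr_ge0.
have d0 : (0 < kk j.+1 - kk j)%R by rewrite subr_gt0.
have dE : (kk j.+1 - kk j = K * e j / 2)%R by rewrite /kk eS; field.
have C0 : (0 <= 8 * c ^+ 5 * C2 ^+ 2)%R.
  by rewrite mulr_ge0 ?sqr_ge0// mulr_ge0// exprn_ge0// ltW.
have p4 : (4 ^+ m0 = (2 ^+ m0) ^+ 2 :> R)%R.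
  by rewrite -exprM mulnC exprM; congr (_ ^+ _)%R; ring.
have two0 : (2 ^+ m0 != 0 :> R)%R by rewrite expf_neq0.
(* The factor [e j ^+ 2] of [rho ^+ 2] cancels the growth of [QQ j], so the coefficient does not
   depend on [j] and [m0_energy] bounds it. *)
have t1 : (8 * c ^+ 5 * C2 ^+ 2 * (rad * e j / 2 ^+ m0) ^+ 2 * (QQ j * xx j) <=
    lam / 2 * xx j)%R.
  apply: (@le_trans _ _ (8 * c ^+ 5 * C2 ^+ 2 * (rad * e j / 2 ^+ m0) ^+ 2 * (Qb * xx j))%R).
    by rewrite ler_wpM2l// mulr_ge0// sqr_ge0.
  rewrite (_ : (_ * (Qb * xx j)) = 8 * c ^+ 5 * C2 ^+ 2 * P / 4 ^+ m0 * xx j)%R.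
    by rewrite ler_wpM2r.
  rewrite p4 /Qb; move: (xx j) (2 ^+ m0)%R two0 => x q q0.
  by field; rewrite q0 !gt_eqF.
have cl : ((c ^+ 2) ^+ j * lam ^+ j = e j ^+ 6)%R.
  rewrite -exprMn /e -exprM mulnC exprM; congr (_ ^+ _)%R.
  by rewrite /lam; field; rewrite gt_eqF.
(* One factor [xx j] is kept; the other supplies [y0 * lam ^+ j], whose power of [lam] cancels the
   growth in [j] and leaves the left side of [y0_small]. *)
have t2 : (2 * c ^+ (2 * (m0 + j).+1) * (QQ j * xx j / (kk j.+1 - kk j)) ^+ 2 / V *
    (b - aa j.+1) <= lam / 2 * xx j)%R.
  have c0 : (0 <= 2 * c ^+ (2 * (m0 + j).+1))%R by rewrite mulr_ge0// exprn_ge0// ltW.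
  apply: (@le_trans _ _ (2 * c ^+ (2 * (m0 + j).+1) *
      (Qb * xx j / (kk j.+1 - kk j)) ^+ 2 / V * (rad ^+ 2 / 8))%R).
    apply: ler_pM => //.
    - by rewrite divr_ge0 ?(ltW V_gt0)// mulr_ge0// sqr_ge0.
    - by rewrite subr_ge0 ltW.
    rewrite ler_wpM2r ?invr_ge0 ?(ltW V_gt0)// ler_wpM2l//.
    rewrite lerXn2r ?nnegrE ?divr_ge0 ?(ltW d0)//.
      exact: le_trans Qx.
    by rewrite ler_wpM2r// invr_ge0 ltW.
  rewrite (_ : (_ * (rad ^+ 2 / 8)) =
      c ^+ (2 * m0.+1) * P ^+ 2 * y0 * xx j)%R; first by rewrite ler_wpM2r.
  have -> : (c ^+ (2 * (m0 + j).+1) = c ^+ (2 * m0.+1) * (c ^+ 2) ^+ j)%R.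
    by rewrite -exprM -exprD -mulnDr addSn.
  have clE : ((c ^+ 2) ^+ j = e j ^+ 6 / lam ^+ j)%R.
    by rewrite -cl mulfK// expf_neq0// gt_eqF.
  rewrite clE dE /Qb /xx.
  have l0 : (lam ^+ j != 0)%R by rewrite expf_neq0// gt_eqF.
  move: (c ^+ (2 * m0.+1))%R (lam ^+ j)%R l0 => cc l l0.
  by field; rewrite l0 !gt_eqF.
rewrite (_ : xx j.+1 = lam / 2 * xx j + lam / 2 * xx j)%R; last first.
  have -> : (lam / 2 * xx j + lam / 2 * xx j = lam * xx j)%R.
    by move: (lam) (xx j) => l x; field.
  by rewrite /xx [(lam ^+ _.+1)%R]exprS mulrCA.
exact: lerD.
Qed.

(** The supremum part of the energy estimate bounds every time slice by a multiple of
    [4^j lam^j <= 2^-j], and all levels [kk j] are at most [K]. Hence the conclusion holds at every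
    time of the interval. *)
Lemma truncation_vanishes t : `](b - rad ^+ 2 / 16)%R, b[%classic t ->
  \int[mu]_(x in ball x0 (rad / 2)%R) ((Num.max (u x t - K) 0)%R ^+ 2)%:E = 0.
Proof.
move=> tb.
have bound j : \int[mu]_(x in ball x0 (rad / 2)%R) ((Num.max (u x t - K) 0)%R ^+ 2)%:E <=
    (P * y0 * V * K ^+ 2 * 2^-1 ^+ j)%:E.
  have [sup _] : _ /\ _ := caccioppoli (en (kk j)) gamma_gt0 (rm_gt0 j) (rm_lt_rr j)
    (aa_lt j) (aa_ltb j.+1) (@sub_j j) (aa_gt0 j) bT (time_j j) (decay j) (erefl (QQ j)).
  have tj : `]aa j.+1, b[%classic t.
    move: tb; rewrite /= !in_itv /= => /andP[bt ->]; rewrite andbT.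
    apply: le_lt_trans bt; have := ab_ge j.+1; lra.
  apply: (@le_trans _ _ (QQ j * xx j)%:E).
    apply: le_trans (sup t tj).
    apply: (@le_trans _ _ (\int[mu]_(x in ball x0 (rad / 2)%R)
       ((Num.max (u x t - kk j) 0)%R ^+ 2)%:E)).
      apply: le_lower_integral => y _; rewrite lee_fin ?sqr_ge0//.
      by rewrite le_truncation// /kk ger_pMr// gerBl ltW.
    apply: subset_lower_integral => [|y _]; last by rewrite lee_fin sqr_ge0.
    by apply: subset_ball; rewrite mdistxx add0r ltW.
  rewrite lee_fin; apply: (le_trans (ler_wpM2r (xx_ge0 j) (QQ_le j))).
  rewrite (_ : (_ * xx j) = P * y0 * V * K ^+ 2 * (lam ^+ j / e j ^+ 2))%R; last first.
    by rewrite /xx; field; rewrite !gt_eqF.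
  rewrite ler_wpM2l//.
    by rewrite mulr_ge0 ?sqr_ge0// mulr_ge0 ?(ltW V_gt0)// mulr_ge0// ltW.
  rewrite ler_pdivrMr// /e -exprM mulnC exprM -exprMn lerXn2r ?nnegrE ?(ltW lam_gt0)//.
  rewrite /lam -[leLHS]div1r ler_pdivrMr ?exprn_gt0 ?mulr_gt0//.
  by have := doubling_ge1 dbl; nra.
apply/eqP; rewrite eq_le integral_ge0 ?andbT; last first.
  by move=> y _; rewrite lee_fin sqr_ge0.
apply/lee_addgt0Pr => eps eps0; rewrite add0e.
set Z := (P * y0 * V * K ^+ 2)%R in bound.
have Z0 : (0 <= Z)%R.
  by rewrite /Z mulr_ge0 ?sqr_ge0// mulr_ge0 ?(ltW V_gt0)// mulr_ge0// ltW.
have K1 : (0 < eps / (Z + 1))%R by rewrite divr_gt0// ltr_pwDr.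
have [n /[!add0r] ne] := ltr_add_invr K1.
apply: (le_trans (bound n.+1)); rewrite lee_fin.
have n2 : (2^-1 ^+ n.+1 <= n.+1%:R^-1 :> R)%R.
  rewrite exprVn lef_pV2 ?posrE ?exprn_gt0// -natrX ler_nat ltnW//.
  exact: ltn_expl.
apply: (le_trans (ler_wpM2l Z0 n2)).
rewrite ltr_pdivlMr in ne; last by rewrite ltr_pwDr.
have : (0 <= n.+1%:R^-1 :> R)%R by rewrite invr_ge0.
by move: (n.+1%:R^-1 : R)%R ne => q; lra.
Qed.

End iteration.

(** * Constants, and passage from time slices to the essential supremum *)

(** The order of choice matters: [m0] settles the geometry and the linear part of a step, and [y0]
    must then compensate the factor [c ^+ (2 * m0.+1)]. *)
Lemma de_giorgi_constants (R : realType) (gamma c C2 Lam : R) :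
  0 < gamma -> 1 <= c -> 0 < C2 -> 1 <= Lam ->
  exists (m0 : nat) (y0 : R), [/\ 0 < y0, 16 * (1 + Lam) < 2 ^+ m0,
    8 * c ^+ 5 * C2 ^+ 2 * (10 * 16 ^+ 2 * gamma) / 4 ^+ m0 <= (8 * c) ^- 2 / 2 &
    c ^+ (2 * m0.+1) * (10 * 16 ^+ 2 * gamma) ^+ 2 * y0 <= (8 * c) ^- 2 / 2].
Proof.
move=> ga0 c1 C20 Lam1; have c0 : 0 < c by exact: lt_le_trans c1.
pose P := 10 * 16 ^+ 2 * gamma.
have P0 : 0 < P by rewrite mulr_gt0// mulr_gt0// exprn_gt0.
pose l := (8 * c) ^- 2 / 2.
have l0 : 0 < l by rewrite divr_gt0// invr_gt0 exprn_gt0// mulr_gt0.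
pose D := 8 * c ^+ 5 * C2 ^+ 2 * P.
have D0 : 0 < D by rewrite mulr_gt0// mulr_gt0 ?exprn_gt0// mulr_gt0// exprn_gt0.
pose A := 16 * (1 + Lam) + D / l.
have [m0 Am0] : exists m : nat, A < 2 ^+ m.
  exists (Num.truncn A).+1; apply: (lt_trans (truncnS_gt A)).
  by rewrite -natrX ltr_nat ltn_expl.
have L0 : 0 <= 16 * (1 + Lam) by rewrite mulr_ge0// addr_ge0// (le_trans _ Lam1).
have Dl0 : 0 < D / l by rewrite divr_gt0.
exists m0, (l / (c ^+ (2 * m0.+1) * P ^+ 2)); split.
- by rewrite divr_gt0// mulr_gt0// exprn_gt0.
- by apply: lt_trans Am0; rewrite ltrDl.
- rewrite -/P -/D -/l ler_pdivrMr ?exprn_gt0// mulrC -ler_pdivrMr//.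
  apply: (@le_trans _ _ (2 ^+ m0)).
    by apply: le_trans (ltW Am0); rewrite lerDr.
  by rewrite lerXn2r ?nnegrE// ler_nat.
rewrite -/P -/l mulrCA divff ?mulr1// mulf_neq0// ?expf_neq0// gt_eqF//.
Qed.

Lemma ae_le_of_truncation (R : realType) d (T : measurableType d)
    (mu : {measure set T -> \bar R}) (A : set T) (w : T -> R) (K : R) :
  measurable A -> ae_measurable mu A w ->
  (\int[mu]_(x in A) ((Num.max (w x - K) 0) ^+ 2)%:E = 0)%E ->
  {ae mu, forall x, A x -> w x <= K}.
Proof.
move=> mA [w' mw' ww'] I0.
have mt : measurable_fun A (fun x => ((Num.max (w' x - K) 0) ^+ 2)%:E).
  apply/measurable_EFinP; apply: measurable_funX.
  by apply: measurable_maxr => //; apply: measurable_funB.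
have : (\int[mu]_(x in A) `|((Num.max (w' x - K) 0) ^+ 2)%:E| = 0)%E.
  rewrite -[RHS]I0; apply: ae_eq_lower_integral => [x _|x _|].
  - by rewrite lee_fin.
  - by rewrite lee_fin sqr_ge0.
  by apply: filterS ww' => x wx Ax; rewrite wx//= ger0_norm// sqr_ge0.
move=> I1; have := (ae_eq_integral_abs mu mA mt).1 I1.
apply: filterS2 ww' => x wx h Ax.
have := h Ax; move=> /= -[] /eqP; rewrite sqrf_eq0 -(wx Ax) => /eqP mx.
have : w x - K <= Num.max (w x - K) 0 by rewrite le_max lexx.
by rewrite mx subr_le0.
Qed.

Section one_sided.
Context (R : realType) (X : completeMetricType R).
Variable mu : {measure set (borel X) -> \bar R}.
Local Open Scope ereal_scope.
Variables (c C2 Lam gamma : R) (m0 : nat) (y0 : R).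
Hypothesis dbl : doubling_with mu c.
Hypothesis C2_gt0 : (0 < C2)%R.
Hypothesis Lam_ge1 : (1 <= Lam)%R.
Hypothesis poinc : poincare mu C2 Lam.
Hypothesis gamma_gt0 : (0 < gamma)%R.
Hypothesis y0_gt0 : (0 < y0)%R.
Hypothesis m0_big : (16 * (1 + Lam) < 2 ^+ m0)%R.
Hypothesis m0_energy :
  (8 * c ^+ 5 * C2 ^+ 2 * (10 * 16 ^+ 2 * gamma) / 4 ^+ m0 <= (8 * c) ^- 2 / 2)%R.
Hypothesis y0_small :
  (c ^+ (2 * m0.+1) * (10 * 16 ^+ 2 * gamma) ^+ 2 * y0 <= (8 * c) ^- 2 / 2)%R.

Lemma ae_le_level (Omega : set X) (T : R) (u : X -> R -> R) (x0 : X)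
    (rad s1 s2 K t : R) :
  open Omega ->
  (forall l : R, energy_estimates mu Omega T gamma
    (fun x t => Num.max (u x t - l) 0)%R) ->
  (forall V t, well_inside Omega V -> `]0%R, T[%classic t -> L2on mu V (u ^~ t)) ->
  (0 < rad)%R -> (2 * (s2 - s1) = rad ^+ 2)%R ->
  ball x0 rad `*` `]s1, s2[ `<=` Omega `*` `]0%R, T[ ->
  (0 < K)%R ->
  \int[lebesgue_measure]_(t in `]s1, s2[)
    \int[mu]_(x in ball x0 rad) ((u x t) ^+ 2)%:E <=
    (y0 * vol mu x0 rad * rad ^+ 2 * K ^+ 2)%:E ->
  `]((s1 + s2) / 2)%R, s2[%classic t ->
  {ae mu, forall x : borel X, ball x0 (rad / 2)%R x -> (u x t <= K)%R}.
Proof.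
move=> oO en L2u rad0 s12 sub K0 uI; rewrite /= in_itv /= => /andP[s12t ts2].
have rad20 : (0 < rad ^+ 2)%R by rewrite exprn_gt0.
(* The final time depends on [t]: the energy estimates need [b < T], while [s2] may equal [T]. It is
   close enough to [t] for [t] to lie in the last [rad ^+ 2 / 16]; since [t] exceeds the midpoint,
   which is [s1 + rad ^+ 2 / 4], the depth [rad ^+ 2 / 4] is available. *)
pose b := (t + Num.min ((s2 - t) / 2) (rad ^+ 2 / 32))%R.
have h1 : (b <= t + (s2 - t) / 2)%R by rewrite lerD2l ge_min lexx.
have h2 : (b <= t + rad ^+ 2 / 32)%R by rewrite lerD2l ge_min lexx orbT.
have tb : (t < b)%R by rewrite ltrDl lt_min divr_gt0 ?subr_gt0// divr_gt0.
have inT s : (s1 < s)%R -> (s < s2)%R -> `]0%R, T[%classic s.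
  move=> s1s ss2; have [] // := sub (x0, s); split => /=.
    by rewrite ballEmdist /= mdistxx.
  by rewrite in_itv /= s1s.
have [|_ bT] := andP (_ : 0 < b < T)%R.
  by have /= := inT b; rewrite in_itv /=; apply; lra.
have tT : `]0%R, T[%classic t by apply: inT => //; lra.
have BO : ball x0 rad `<=` Omega.
  move=> y yr; have [] // := sub (y, t); split => //=.
  by rewrite in_itv /= ts2 andbT; lra.
have wi : well_inside Omega (ball x0 (rad / 2)%R).
  by apply: well_inside_ball BO; lra.
apply: ae_le_of_truncation; first exact: measurable_mball.
  by have [] := L2u _ t wi tT.
apply: (truncation_vanishes dbl C2_gt0 Lam_ge1 poinc oO gamma_gt0 en L2u rad0 bT
  _ K0 (ltW y0_gt0) m0_big m0_energy y0_small).
- apply: subset_trans sub => -[y s] [/= yr]; rewrite in_itv /= => /andP[bs sb].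
  by split => //=; rewrite in_itv /=; apply/andP; split; lra.
- apply: le_trans uI.
  apply: (@le_trans _ _ (\int[lebesgue_measure]_(t in `](b - rad ^+ 2 / 8)%R, b[)
    \int[mu]_(x in ball x0 rad) ((u x t) ^+ 2)%:E)).
    apply: le_lower_integral => s _.
      by apply: integral_ge0 => y _; rewrite lee_fin sqr_ge0.
    apply: (@le_trans _ _ (\int[mu]_(x in ball x0 rad) ((Num.max (u x s) 0)%R ^+ 2)%:E)).
      apply: subset_lower_integral => [|y _]; last by rewrite lee_fin sqr_ge0.
      by apply: subset_ball; rewrite mdistxx add0r; lra.
    apply: le_lower_integral => y _; rewrite lee_fin ?sqr_ge0//.
    have [u0|u0] := leP (u y s) 0%R; last by [].
    by rewrite expr0n /= sqr_ge0.
  apply: subset_lower_integral => [s /=|s _].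
    by rewrite !in_itv /= => /andP[bs sb]; apply/andP; split; lra.
  by apply: integral_ge0 => y _; rewrite lee_fin sqr_ge0.
rewrite /= in_itv /= tb andbT; lra.
Qed.

End one_sided.

(** The set where [w > K] need not be measurable, so Tonelli is applied to a measurable
    representative [v]. For almost every [t] the section of the null set [N] is null, and off it [v]
    and [w] agree on the domain. *)
Lemma ae_product_of_sections (R : realType) d1 d2 (T1 : measurableType d1)
    (T2 : measurableType d2) (m1 : {sigma_finite_measure set T1 -> \bar R})
    (m2 : {sigma_finite_measure set T2 -> \bar R}) (D1 : set T1) (D2 : set T2)
    (w : T1 * T2 -> R) (K : R) :
  measurable D1 -> measurable D2 ->
  ae_measurable (m1 \x m2)%E (D1 `*` D2) w ->
  (forall t, D2 t -> {ae m1, forall x, D1 x -> w (x, t) <= K}) ->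
  {ae (m1 \x m2)%E, forall z, (D1 `*` D2) z -> w z <= K}.
Proof.
move=> mD1 mD2 [v mv [N [mN N0 Nvw]]] wK.
have mD := measurableX mD1 mD2.
pose E := (D1 `*` D2) `&` [set z | K < v z].
have mE : measurable E.
  rewrite /E (_ : [set z | K < v z] = v @^-1` `]K, +oo[); first exact: mv.
  by apply/seteqP; split => z /=; rewrite in_itv /= andbT.
have section_formula (A : set (T1 * T2)) : measurable A ->
    ((m1 \x m2) A = \int[m2]_y (m1 (ysection A y)))%E.
  move=> mA; have := indic_fubini_tonelli m1 m2 mA.
  by rewrite indic_fubini_tonelli_FE// indic_fubini_tonelli_GE.
have N0y : {ae m2, forall y, m1 (ysection N y) = 0%E}.
  have Ny : (\int[m2]_y m1 (ysection N y) = 0)%E.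
    by rewrite -section_formula//; exact: N0.
  have mNy : measurable_fun setT (fun y => m1 (ysection N y)).
    exact: measurable_fun_ysection.
  have : (\int[m2]_y `|m1 (ysection N y)| = 0)%E.
    by rewrite -[RHS]Ny; apply: eq_integral => y _; rewrite gee0_abs.
  move=> I1; have := (ae_eq_integral_abs m2 measurableT mNy).1 I1.
  by apply: filterS => y; apply.
have E0 : (m1 \x m2)%E E = 0%E.
  rewrite section_formula//.
  have -> : 0%E = (\int[m2]_y (cst 0 y))%E :> \bar R by rewrite integral0.
  apply: ae_eq_lower_integral => //.
  apply: filterS N0y => y Ny _ /=.
  have mEy : measurable (ysection E y) by exact: measurable_ysection.
  have [D2y|D2y] := pselect (D2 y); last first.
    rewrite (_ : ysection E y = set0) ?measure0//.
    by apply/seteqP; split => // x; rewrite /ysection /= inE => -[[]].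
  apply/(negligibleP _ mEy).
  have nN : m1.-negligible (ysection N y).
    by apply/negligibleP => //; exact: measurable_ysection.
  have := negligibleU nN (wK y D2y); apply: negligibleS => x.
  rewrite /ysection /= !inE => -[[/= D1x _] vK].
  have [Nxy|Nxy] := pselect (N (x, y)); [by left|right => /=].
  move=> /(_ D1x); apply/negP; rewrite -ltNge.
  suff -> : w (x, y) = v (x, y) by [].
  by apply: contrapT => wv; apply: Nxy; apply: Nvw => /= /(_ (conj D1x D2y)).
exists (N `|` E); split; first exact: measurableU.
  by apply: null_set_setU.
move=> z /= /not_implyP[Dz wzK].
have [Nz|Nz] := pselect (N z); [by left|right; split => //=].
suff <- : w z = v z by rewrite ltNge; apply/negP.
by apply: contrapT => wv; apply: Nz; apply: Nvw => /= /(_ Dz).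
Qed.

(** Allows a doubling constant to be fixed from the infimum alone, before the space is given and
    without showing that the infimum is attained. *)
Lemma doubling_with_gt_constant (R : realType) (X : completeMetricType R)
    (mu : {measure set (borel X) -> \bar R}) (c : R) :
  doubling mu -> doubling_constant mu < c -> doubling_with mu c.
Proof.
move=> [c0 dc0] cmu.
have hi : has_inf [set c | doubling_with mu c].
  by split; [exists c0|exists 1 => c' []].
have e0 : 0 < c - doubling_constant mu by rewrite subr_gt0.
have [c' [c'1 dc']] := inf_adherent e0 hi.
rewrite -/(doubling_constant mu) subrKC => c'c.
split; first exact: le_trans (ltW c'c).
move=> x r r0; have [b0 bc boo] := dc' x r r0.
have le_c : (c'%:E * mu (ball x r) <= c%:E * mu (ball x r))%E.
  by rewrite lee_wpmul2r// lee_fin ltW.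
split=> //; first exact: le_trans le_c.
have c'0 : 0 < c' by exact: lt_le_trans c'1.
have moo : (mu (ball x r) < +oo)%E.
  rewrite ltey; apply/negP => /eqP mE; move: boo.
  by rewrite mE gt0_muley// lte_fin.
by rewrite lte_mul_pinfty// lee_fin (le_trans (ltW c'0)) ?ltW.
Qed.

Section slices.
Context (R : realType) (X : completeMetricType R).
Variable mu : {measure set (borel X) -> \bar R}.

(** Square integrability at every time, and not just at almost every one, comes from the
    representative in [C_L2loc], which agrees with [u] inside the time interval. *)
Lemma L2on_slice (Omega : set X) (T : R) (u : X -> R -> R) (V : set X) (t : R) :
  C_L2loc mu Omega T u -> well_inside Omega V -> `]0, T[%classic t ->
  L2on mu V (u ^~ t).
Proof.
move=> [w wu wL] VO tT; have tT' : `[0, T]%classic t.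
  by move: tT; rewrite /= !in_itv /= => /andP[/ltW-> /ltW->].
have [[[w' mw' ww'] w2] _] := wL V VO t tT'.
have uw x : V x -> u x t = w x t.
  by move=> Vx; rewrite wu//; have [_ _] := VO; apply; exact: subset_closure.
split.
  by exists w' => //; apply: filterS ww' => x wx Vx; rewrite uw// wx.
rewrite (_ : integral _ _ _ = \int[mu]_(x in V) ((w x t) ^+ 2)%:E)%E//.
by apply: eq_integral => x /set_mem /uw ->.
Qed.

Lemma L2onN (V : set X) (w : X -> R) :
  L2on mu V w -> L2on mu V (fun x => - w x).
Proof.
move=> [[w' mw' ww'] w2]; split.
  exists (fun x => - w' x); first exact: measurable_funN.
  by apply: filterS ww' => x wx Vx; rewrite wx.
by under eq_integral do rewrite sqrrN.
Qed.

End slices.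

(* If B_R(x0) x ]s1, s2[ is not well inside the domain, the right-hand side
   may be +oo. *)
Theorem theorem4p3 (R : realType) (cd gamma C2 Lam : R)
    (gamma_gt0 : 0 < gamma) (C2_gt0 : 0 < C2) (Lam_ge1 : 1 <= Lam) :
  exists cinf : R, 0 < cinf /\
  forall (X : completeMetricType R) (mu : {measure set (borel X) -> \bar R}),
    doubling mu -> doubling_constant mu = cd -> poincare mu C2 Lam ->
  forall (Omega : set X) (T : R),
    open Omega -> Omega !=set0 -> 0 < T ->
  forall u : X -> R -> R, DG mu Omega T gamma u ->
  forall (x0 : X) (rad s1 s2 : R),
    0 < rad -> s1 < s2 -> 2 * (s2 - s1) = rad ^+ 2 ->
    ball x0 rad `*` `]s1, s2[ `<=` Omega `*` `]0, T[ ->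
    (ess_sup_on (mu \x lebesgue_measure)
       (ball x0 (rad / 2)%R `*` `]((s1 + s2) / 2)%R, s2[)
       (fun z => `|u z.1 z.2|%:E)
     <= cinf%:E *
        (((fine (mu (ball x0 rad)) * (s2 - s1))^-1)%R%:E *
         \int[lebesgue_measure]_(t in `]s1, s2[)
           \int[mu]_(x in ball x0 rad) (`|u x t| ^+ 2)%R%:E) `^ 2^-1)%E.
Proof.
(* A constant strictly above [cd]; the maximum keeps it at least 1 for an arbitrary real [cd]. *)
pose c := Num.max (cd + 1) 1.
have c1 : 1 <= c by rewrite le_max lexx orbT.
have [m0 [y0 [y0_gt0 m0_big m0_energy y0_small]]] :=
  de_giorgi_constants gamma_gt0 c1 C2_gt0 Lam_ge1.
(* Solves [I = y0 * vol * rad^2 * K^2] for [K]; the 2 comes from [rad^2 = 2 (s2 - s1)]. *)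
pose cinf := Num.sqrt (2 * y0)^-1.
have cinf0 : 0 < cinf by rewrite sqrtr_gt0 invr_gt0 mulr_gt0.
exists cinf; split => // X mu dbl0 cdE poinc Omega T oO _ T0 u DGu x0 rad s1 s2.
move=> rad0 s12 s12E sub.
have dbl : doubling_with mu c.
  by apply: doubling_with_gt_constant => //; rewrite cdE lt_max ltrDl ltr01.
have [nu nuE] := sigma_finite_doubling_measure dbl.
have V0 := vol_gt0 dbl x0 rad0; rewrite /vol in V0.
have [[[au cu _] en] [_ en']] := DGu.
have rad20 : 0 < rad ^+ 2 by rewrite exprn_gt0.
set I := (\int[lebesgue_measure]_(t in _) _)%E.
have I0 : (0 <= I)%E.
  apply: integral_ge0 => t _; apply: integral_ge0 => x _.
  by rewrite lee_fin sqr_ge0.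
have VD0 : 0 < (fine (mu (ball x0 rad)) * (s2 - s1))^-1.
  by rewrite invr_gt0 mulr_gt0// subr_gt0.
have [Ioo|Ifin] := eqVneq I +oo%E.
  by rewrite Ioo gt0_muley ?lte_fin// poweRyr// gt0_muley ?lte_fin// leey.
have Ir : I \is a fin_num by rewrite ge0_fin_numE// ltey.
have IE : I = (\int[lebesgue_measure]_(t in `]s1, s2[)
    \int[mu]_(x in ball x0 rad) ((u x t) ^+ 2)%:E)%E.
  by do 2 (apply: eq_integral => ? _); rewrite real_normK// num_real.
have IEN : I = (\int[lebesgue_measure]_(t in `]s1, s2[)
    \int[mu]_(x in ball x0 rad) ((- u x t) ^+ 2)%:E)%E.
  by rewrite IE; do 2 (apply: eq_integral => ? _); rewrite sqrrN.
have level (K : R) : 0 < K ->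
    (I <= (y0 * vol mu x0 rad * rad ^+ 2 * K ^+ 2)%:E)%E ->
    (ess_sup_on (mu \x lebesgue_measure)
       (ball x0 (rad / 2)%R `*` `]((s1 + s2) / 2)%R, s2[)
       (fun z => `|u z.1 z.2|%:E) <= K%:E)%E.
  move=> K0 IK; apply: ereal_inf_lbound => /=.
  have L2u V t := @L2on_slice _ _ mu Omega T u V t cu.
  (* The positive part of [-u - l] is the negative part of [u - (-l)], so the class for negative
     parts yields the estimates for [-u]. *)
  have enN l : energy_estimates mu Omega T gamma
      (fun x t => Num.max (- u x t - l) 0).
    rewrite (_ : (fun _ _ => _) = fun x t => Num.max (- (u x t - (- l))) 0)//.
    by apply/funext => x; apply/funext => t; rewrite opprB [in RHS]addrC.
  have up t : `]((s1 + s2) / 2)%R, s2[%classic t ->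
      {ae mu, forall x : borel X, ball x0 (rad / 2)%R x -> u x t <= K}.
    apply: (ae_le_level dbl C2_gt0 Lam_ge1 poinc gamma_gt0 y0_gt0 m0_big
      m0_energy y0_small oO en L2u rad0 s12E sub K0).
    by rewrite -IE.
  have dn t : `]((s1 + s2) / 2)%R, s2[%classic t ->
      {ae mu, forall x : borel X, ball x0 (rad / 2)%R x -> - u x t <= K}.
    apply: (ae_le_level dbl C2_gt0 Lam_ge1 poinc gamma_gt0 y0_gt0 m0_big
      m0_energy y0_small (u := fun x t => - u x t) oO enN _ rad0 s12E sub K0).
      by move=> V s VO sT; apply: L2onN; exact: L2u.
    by rewrite -IEN.
  have half : ball x0 (rad / 2) `<=` ball x0 rad.
    by apply: subset_ball; rewrite mdistxx add0r; lra.
  have subh : ball x0 (rad / 2)%R `*` `]((s1 + s2) / 2)%R, s2[ `<=`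
      Omega `*` `]0, T[.
    apply: subset_trans sub => -[x t] [/= /half xr]; rewrite in_itv /= => /andP[st ts].
    by split => //=; rewrite in_itv /= ts andbT; lra.
  (* The product measure depends only on the set functions, so null sets pass between [mu] and its
     sigma-finite copy [nu]. *)
  have nm A : product_measure1 nu lebesgue_measure A =
      product_measure1 mu lebesgue_measure A.
    by rewrite /product_measure1 nuE.
  have mI : measurable (`]((s1 + s2) / 2)%R, s2[%classic : set (measurableTypeR R)).
    exact: measurable_itv.
  have auN : ae_measurable (nu \x lebesgue_measure)%E
      (ball x0 (rad / 2)%R `*` `]((s1 + s2) / 2)%R, s2[) (fun z => `|u z.1 z.2|).
    have [v mv [N [mN N0 vN]]] := au.
    exists (fun z => `|v z|).
      apply: measurableT_comp => //; apply: measurable_funS mv => //.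
      by apply: measurableX => //; exact: sub_sigma_algebra.
    exists N; split => //.
      exact: etrans (nm N) N0.
    apply: subset_trans vN => z /= zN vz; apply: zN => /subh /vz.
    by case: z {vz} => x t /= ->.
  have sec t : `]((s1 + s2) / 2)%R, s2[%classic t ->
      {ae nu, forall x : borel X, ball x0 (rad / 2)%R x -> `|u x t| <= K}.
    move=> tt; have [N [mN N0 sN]] := filterI (up t tt) (dn t tt).
    exists N; split => //; first by rewrite nuE.
    apply: subset_trans sN => x /= xN [ux nx]; apply: xN => xr.
    by rewrite ler_norml lerNl ux// nx.
  have [N [mN N0 sN]] := ae_product_of_sections (m2 := lebesgue_measure)
    (measurable_mball x0 (rad / 2)) mI auN sec.
  exists N; split => //.
    exact: etrans (esym (nm N)) N0.
pose q := (fine (mu (ball x0 rad)) * (s2 - s1))^-1 * fine I.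
have q0 : 0 <= q by rewrite mulr_ge0 ?(ltW VD0)// fine_ge0.
have -> : (((fine (mu (ball x0 rad)) * (s2 - s1))^-1%:E * I) `^ 2^-1)%E =
    (Num.sqrt q)%:E.
  by rewrite -{1}(fineK Ir) -EFinM poweR_EFin powR12_sqrt.
(* The level must be positive while [q] may be 0, hence the added [eps]. *)
rewrite -EFinM; apply/lee_addgt0Pr => eps eps0; rewrite -EFinD.
have cq0 : 0 <= cinf * Num.sqrt q by rewrite mulr_ge0 ?sqrtr_ge0// ltW.
apply: level; first by rewrite ltr_wpDl.
rewrite -(fineK Ir) lee_fin.
have Kq : (cinf * Num.sqrt q) ^+ 2 <= (cinf * Num.sqrt q + eps) ^+ 2.
  by rewrite lerXn2r ?nnegrE ?addr_ge0 ?lerDl// ltW.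
have V0' : 0 < y0 * vol mu x0 rad * rad ^+ 2 by rewrite !mulr_gt0.
apply: le_trans (ler_wpM2l (ltW V0') Kq).
rewrite exprMn (sqr_sqrtr q0) sqr_sqrtr; last by rewrite invr_ge0 mulr_ge0// ltW.
rewrite /q -s12E /vol le_eqVlt; apply/orP; left; apply/eqP.
by field; rewrite !gt_eqF// subr_gt0.
Qed.
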